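(* Let $f$ be a non-degenerate Hermitian or quadratic form of finite Witt index $n\ge2$ on a vector space $V$ over a field, with infinite anisotropic defect $d$, and let $\mathcal P=\mathcal P(f)$. Then (1) every maximal well ordered chain of $\mathfrak N(\mathcal P)$ has length $d$; (2) every well ordered chain of $\mathfrak N(\mathcal P)$ is contained in a maximal well ordered chain of $\mathfrak N(\mathcal P)$.
   Context: Anisotropic defect: $V=V_1\oplus\cdots\oplus V_n\oplus V_0$, $V_i$ pairwise orthogonal hyperbolic planes, $V_0$ anisotropic and orthogonal to them, $d=\dim V_0$ (a cardinal). Points of $\mathcal P(f)$: isotropic/singular 1-spaces; lines: totally isotropic/singular 2-spaces. A subspace is a set of points containing every line meeting it in $\ge2$ points; a nice subspace contains two mutually disjoint maximal singular subspaces of $\mathcal P$; $\mathfrak N(\mathcal P)$ is the poset of nice subspaces under inclusion. ''Maximal well ordered chain'' means maximal among well ordered chains. Length of a chain is its cardinality minus $1$ (equal to the cardinality when infinite). *)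

(* Defs.v *)
From HB Require Import structures.
From mathcomp Require Import all_boot all_order all_algebra.
Set Implicit Arguments. Unset Strict Implicit. Unset Printing Implicit Defensive.
Import GRing.Theory.
Local Open Scope ring_scope.

Section PolarSpace.
Variables (K : fieldType) (V : lmodType K).

Definition involution (s : K -> K) : Prop :=
  [/\ forall x y, s (x + y) = s x + s y,
      forall x y, s (x * y) = s x * s y,
      s 1 = 1,
      forall x, s (s x) = x
    & exists x, s x <> x].

Definition hermitian (s : K -> K) (f : V -> V -> K) : Prop :=
  [/\ forall x y z, f (x + y) z = f x z + f y z,
      forall (a : K) x y, f (a *: x) y = a * f x y
    & forall x y, f y x = s (f x y)].

Definition polar (q : V -> K) (x y : V) : K := q (x + y) - q x - q y.

Definition quadratic (q : V -> K) : Prop :=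
  [/\ forall (a : K) x, q (a *: x) = a ^+ 2 * q x,
      forall x y z, polar q (x + y) z = polar q x z + polar q y z,
      forall (a : K) x y, polar q (a *: x) y = a * polar q x y
    & forall x y, polar q x y = polar q y x].

Inductive pform : Type :=
  | Herm of (K -> K) & (V -> V -> K)
  | Quad of (V -> K).

Definition bil (F : pform) (u v : V) : K :=
  match F with Herm _ f => f u v | Quad q => polar q u v end.

Definition singular (F : pform) (v : V) : Prop :=
  match F with Herm _ f => f v v = 0 | Quad q => q v = 0 end.

Definition nondeg_form (F : pform) : Prop :=
  match F with
  | Herm s f => [/\ involution s, hermitian s f &
                    forall x, (forall y, f x y = 0) -> x = 0]
  | Quad q => quadratic q /\
              (forall x, q x = 0 -> (forall y, polar q x y = 0) -> x = 0)
  end.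

(** ---- The polar space P(f) ----
   A point <v> (isotropic/singular 1-space) is represented by any nonzero
   singular vector v spanning it; a set of points is represented by the set
   of all nonzero vectors spanning its points, i.e. a predicate on V that
   only contains points and is closed under nonzero scalars. *)

Definition is_point (F : pform) (v : V) : Prop := v <> 0 /\ singular F v.

Definition indep2 (u v : V) : Prop :=
  forall a b : K, a *: u + b *: v = 0 -> a = 0 /\ b = 0.

Definition tot_sing2 (F : pform) (u v : V) : Prop :=
  [/\ singular F u, singular F v & bil F u v = 0].

Definition ptset (F : pform) (X : V -> Prop) : Prop :=
  (forall v, X v -> is_point F v) /\
  (forall (a : K) v, a != 0 -> X v -> X (a *: v)).

Definition subset_pts (X Y : V -> Prop) : Prop := forall v, X v -> Y v.

(** subspace of P: contains every line meeting it in at least two points;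
   the line through distinct collinear points <u>,<v> consists of the
   points <a u + b v>. *)
Definition subspace (F : pform) (X : V -> Prop) : Prop :=
  ptset F X /\
  (forall u v, X u -> X v -> indep2 u v -> tot_sing2 F u v ->
     forall a b : K, a *: u + b *: v <> 0 -> X (a *: u + b *: v)).

Definition sing_subspace (F : pform) (X : V -> Prop) : Prop :=
  subspace F X /\ (forall u v, X u -> X v -> tot_sing2 F u v).

Definition max_sing_subspace (F : pform) (X : V -> Prop) : Prop :=
  sing_subspace F X /\
  (forall Y, sing_subspace F Y -> subset_pts X Y -> subset_pts Y X).

Definition disjoint_pts (X Y : V -> Prop) : Prop := forall v, X v -> Y v -> False.

Definition nice (F : pform) (X : V -> Prop) : Prop :=
  subspace F X /\
  exists M1 M2, [/\ max_sing_subspace F M1, max_sing_subspace F M2,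
                    disjoint_pts M1 M2, subset_pts M1 X & subset_pts M2 X].

Definition chain (F : pform) (C : (V -> Prop) -> Prop) : Prop :=
  (forall X, C X -> nice F X) /\
  (forall X Y, C X -> C Y -> subset_pts X Y \/ subset_pts Y X).

Definition wo_chain (F : pform) (C : (V -> Prop) -> Prop) : Prop :=
  chain F C /\
  (forall D : (V -> Prop) -> Prop, (forall X, D X -> C X) -> (exists X, D X) ->
     exists X, D X /\ forall Y, D Y -> subset_pts X Y).

Definition max_wo_chain (F : pform) (C : (V -> Prop) -> Prop) : Prop :=
  wo_chain F C /\
  (forall C', wo_chain F C' -> (forall X, C X -> C' X) -> forall X, C' X -> C X).

Definition lsubspace (W : V -> Prop) : Prop :=
  [/\ W 0, forall x y, W x -> W y -> W (x + y)
    & forall (a : K) x, W x -> W (a *: x)].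

Definition witt_decomposition (F : pform) (n : nat) (e f : 'I_n -> V)
    (V0 : V -> Prop) : Prop :=
  [/\ (forall i, [/\ singular F (e i), singular F (f i) & bil F (e i) (f i) = 1]),
      (forall i j, i != j ->
         [/\ bil F (e i) (e j) = 0, bil F (e i) (f j) = 0,
             bil F (f i) (e j) = 0 & bil F (f i) (f j) = 0]),
      lsubspace V0 &
    [/\ (forall i x, V0 x ->
         [/\ bil F (e i) x = 0, bil F (f i) x = 0,
             bil F x (e i) = 0 & bil F x (f i) = 0]),
      (forall x, V0 x -> singular F x -> x = 0),
      (forall v : V, exists (a b : 'I_n -> K) (x : V),
          V0 x /\ v = \sum_(i < n) (a i *: e i + b i *: f i) + x)
    & (forall (a b : 'I_n -> K) (x : V), V0 x ->
          \sum_(i < n) (a i *: e i + b i *: f i) + x = 0 ->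
          (forall i, a i = 0 /\ b i = 0) /\ x = 0)]].

Definition hamel_basis_of (W B : V -> Prop) : Prop :=
  [/\ forall b, B b -> W b,
      (forall (s : seq V) (c : V -> K), uniq s -> (forall v, v \in s -> B v) ->
         \sum_(v <- s) c v *: v = 0 -> forall v, v \in s -> c v = 0)
    & (forall x, W x -> exists (s : seq V) (c : V -> K),
         (forall v, v \in s -> B v) /\ x = \sum_(v <- s) c v *: v)].

Definition infinite_set (B : V -> Prop) : Prop :=
  forall s : seq V, exists b, B b /\ b \notin s.

End PolarSpace.

Definition equipotent (A B : Type) (P : A -> Prop) (Q : B -> Prop) : Prop :=
  exists g : {x | P x} -> {y | Q y}, bijective g.

(* Main.v *)
Require Import Defs.
From HB Require Import structures.
From mathcomp Require Import all_boot all_order all_algebra.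
From mathcomp Require Import boolp ring.
From mathcomp Require wochoice.
Set Implicit Arguments. Unset Strict Implicit. Unset Printing Implicit Defensive.
Import GRing.Theory.
Local Open Scope ring_scope.

(** A nice subspace X contains two disjoint maximal singular subspaces; these
    have dual bases e, f of length the Witt index n, so V = <e,f> + U with U
    anisotropic. Because n >= 2, adding collinear points of X moves any point
    e(a) + f(b) + u of X to every other point with the same U-component u, so X
    consists of all the points of its linear span. Nice subspaces thus
    correspond to the linear subspaces containing some such frame e, f.

    A maximal well ordered chain of these starts at some <e,f>, ends at V, is
    closed under unions, and each step has codimension 1. Fix a well ordered
    basis of V; every nonzero vector then has a leading basis element, and each
    step of the chain adds exactly one leading element. This is a bijection
    from the steps to the basis minus the finitely many leading elements of
    <e,f>.

    For the extension property, well order V lexicographically by first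
    membership in the chain and then arbitrarily; the spans of the initial
    segments form a maximal well ordered chain. *)

(** * Cardinals and well orderings *)

(** Codimension 1 steps alone do not count an infinite chain. Leading elements do, because a union
    of members has exactly the leads of its members: a vector never first appears in a limit member,
    so the least member with a given lead is the first member of the chain or the upper end of a
    step. The delicate point about subspaces is Hermitian. Whether e(a) + f(b) + u is singular
    depends, for fixed u, only on the trace of the pairing of a and b, whereas adding a collinear
    point of span e or of span f preserves the pairing itself. Additive Hilbert 90 describes the
    pairings of equal trace, and a second hyperbolic plane supplies a point that realizes the
    change. All frames span subspaces of the same finite dimension 2n, so none of these properly
    contains another. Hence a chain can be started at such a span, and its first member has only
    finitely many leads. *)

Lemma sval_inj (A : Type) (P : A -> Prop) (x y : {x | P x}) :
  sval x = sval y -> x = y.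
Proof.
by case: x y => x Px [y Py] /= xy; subst y; rewrite (Prop_irrelevance Px Py).
Qed.

(** Choice, applied to totality and to surjectivity, yields two mutually inverse maps; bijections
    can thus be given as relations. *)
Lemma equipotent_rel (A B : Type) (P : A -> Prop) (Q : B -> Prop)
    (R : A -> B -> Prop) :
  (forall x, P x -> exists y, Q y /\ R x y) ->
  (forall y, Q y -> exists x, P x /\ R x y) ->
  (forall x y y', P x -> Q y -> Q y' -> R x y -> R x y' -> y = y') ->
  (forall x x' y, P x -> P x' -> Q y -> R x y -> R x' y -> x = x') ->
  equipotent P Q.
Proof.
move=> tot surj func inj.
have [|g gR] := @choice {x | P x} {y | Q y} (fun x y => R (sval x) (sval y)).
  move=> [x Px]; have [y [Qy Rxy]] := tot x Px.
  by exists (exist _ y Qy).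
have [|h hR] := @choice {y | Q y} {x | P x} (fun y x => R (sval x) (sval y)).
  move=> [y Qy]; have [x [Px Rxy]] := surj y Qy.
  by exists (exist _ x Px).
exists g; exists h => [x|y]; apply: sval_inj.
- apply: (inj _ _ (sval (g x))) (hR (g x)) (gR x).
  + exact: (svalP (h (g x))).
  + exact: (svalP x).
  + exact: (svalP (g x)).
- apply: (func (sval (h y))) (gR (h y)) (hR y).
  + exact: (svalP (h y)).
  + exact: (svalP (g (h y))).
  + exact: (svalP y).
Qed.

Lemma equipotent_sym (A B : Type) (P : A -> Prop) (Q : B -> Prop) :
  equipotent P Q -> equipotent Q P.
Proof. by move=> [g [h gK hK]]; exists h; exists g. Qed.

Lemma equipotent_trans (A B D : Type) (P : A -> Prop) (Q : B -> Prop)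
    (R : D -> Prop) :
  equipotent P Q -> equipotent Q R -> equipotent P R.
Proof. by move=> [g gbij] [h hbij]; exists (h \o g); apply: bij_comp. Qed.

Definition dedekind_infinite (A : Type) (P : A -> Prop) : Prop :=
  exists g : nat -> A, injective g /\ forall i, P (g i).

Lemma dedekind_infinite_equipotent (A B : Type) (P : A -> Prop) (Q : B -> Prop) :
  equipotent P Q -> dedekind_infinite P -> dedekind_infinite Q.
Proof.
move=> [h hbij] [g [ginj gP]].
exists (fun i => sval (h (exist _ (g i) (gP i)))); split=> [i j|i]; last first.
  exact: svalP.
move=> /sval_inj/(bij_inj hbij)/(congr1 sval)/=; exact: ginj.
Qed.

Lemma equipotent_add1 (A : Type) (P : A -> Prop) (x : A) :
  dedekind_infinite P -> equipotent (fun y => P y \/ y = x) P.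
Proof.
move=> [g [ginj gP]].
case: (EM (P x)) => [Px|nPx].
  apply: (@equipotent_rel _ _ _ _ (fun y z => y = z)).
  - by move=> y [Py|->]; [exists y|exists x].
  - by move=> y Py; exists y; split=> //; left.
  - by move=> y z z' _ _ _ <-.
  - by move=> y z z' _ _ _ -> <-.
have gx i : g i <> x by move=> gix; apply: nPx; rewrite -gix.
(* Hilbert's hotel: [x] goes to [g 0], each [g i] to [g i.+1], and everything else stays fixed. *)
pose shift y z := (y = x /\ z = g 0%N) \/
  (exists i, y = g i /\ z = g i.+1) \/
  [/\ P y, y = z & forall i, y <> g i].
apply: (@equipotent_rel _ _ _ _ shift).
- move=> y [Py|->]; last by exists (g 0%N); split=> //; left.
  case: (EM (exists i, y = g i)) => [[i ->]|ng].
    by exists (g i.+1); split=> //; right; left; exists i.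
  exists y; split=> //; right; right; split=> // i yi; apply: ng; by exists i.
- move=> z Pz; case: (EM (exists i, z = g i)) => [[[|i] ->]|ng].
  + by exists x; split; [right|left].
  + by exists (g i); split; [left|right; left; exists i].
  + exists z; split; [by left|right; right; split=> // i zi; apply: ng].
    by exists i.
- move=> y z z' _ _ _ [[-> ->]|[[i [-> ->]]|[Py <- yg]]].
  + by case=> [[_ ->]//|[[i [/esym/gx]]//|[/nPx]]].
  + case=> [[/gx]//|[[j [/ginj -> ->]]//|[_ _ /(_ i)]//]].
  + case=> [[yx _]|[[j [/yg]]//|[_ <-]//]].
    by case: nPx; rewrite -yx.
- move=> y y' z Py Py' _ [[-> ->]|[[i [-> ->]]|[Py1 yz yg]]].
  + by case=> [[-> _]//|[[j [_ /ginj]]//|[_ -> /(_ 0%N)]//]].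
  + by case=> [[_ /ginj]//|[[j [-> /ginj [->]]]//|[_ -> /(_ i.+1)]//]].
  + case=> [[_ zg]|[[j [_ zg]]|[_ -> _]//]].
      by case: (yg 0%N); rewrite yz.
    by case: (yg j.+1); rewrite yz.
Qed.

Lemma eq_equipotent (A : Type) (P Q : A -> Prop) :
  (forall x, P x <-> Q x) -> equipotent P Q.
Proof.
move=> PQ; have -> : P = Q by apply/predeqP.
by exists id; exists id.
Qed.

Lemma equipotent_add_seq (A : eqType) (P : A -> Prop) (s : seq A) :
  dedekind_infinite P -> equipotent (fun y => P y \/ y \in s) P.
Proof.
move=> infP; elim: s => [|x s IH].
  by apply: eq_equipotent => y; split=> [[]|]; [| |left].
apply: equipotent_trans IH.
apply: equipotent_trans (equipotent_add1 x _).
  apply: eq_equipotent => y; rewrite inE; split=> [[Py|/orP[/eqP->|ys]]|].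
  - by left; left.
  - by right.
  - by left; right.
  - by case=> [[Py|ys]|->]; [left|right; rewrite ys orbT|right; rewrite eqxx].
by move: infP => [g [gi gP]]; exists g; split=> // i; left.
Qed.

Lemma dedekind_infiniteP (A : eqType) (P : A -> Prop) :
  (forall s : seq A, exists b, P b /\ b \notin s) -> dedekind_infinite P.
Proof.
move=> Pinf.
have [p pP] := choice Pinf.
(* [L n] lists the first [n] choices; each new one avoids all earlier ones. *)
pose fix L n := if n is m.+1 then p (L m) :: L m else [::].
have Lmono i j : (i <= j)%N -> {subset L i <= L j}.
  elim: j => [|j IH]; first by rewrite leqn0 => /eqP ->.
  rewrite leq_eqVlt => /predU1P[->//|/IH sub] x /sub.
  by rewrite inE orbC => ->.
have pne i j : (i < j)%N -> p (L i) <> p (L j).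
  move=> ij eqp; have [_ /negP[]] := pP (L j).
  by rewrite -eqp; apply: (Lmono _ _ ij); rewrite inE eqxx.
exists (fun n => p (L n)); split=> [i j|i]; last by case: (pP (L i)).
by case: (ltngtP i j) => // [/pne//|/pne ne /esym /ne].
Qed.

Lemma strict_well_order (T : eqType) : exists lt : T -> T -> Prop,
  [/\ forall A : T -> Prop, (exists a, A a) ->
        exists a, A a /\ forall x, A x -> ~ lt x a,
      forall x y, [\/ lt x y, x = y | lt y x],
      forall x, ~ lt x x
    & forall x y z, lt x y -> lt y z -> lt x z].
Proof.
have [R Rwo] := wochoice.well_ordering_principle T.
have Rmin (A : T -> Prop) : (exists a, A a) ->
    exists a, A a /\ forall x, A x -> R a x.
  move=> [a Aa]; have [|m [[/asboolP Am mmin] _]] := Rwo (fun x => `[< A x >]).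
    by exists a; apply/asboolP.
  by exists m; split=> // x Ax; apply: mmin; apply/asboolP.
have Rtot x y : R x y \/ R y x.
  have [|z [[->|->] zmin]] := Rmin (fun z => z = x \/ z = y).
  - by exists x; left.
  - by left; apply: zmin; right.
  - by right; apply: zmin; left.
(* Antisymmetry comes from the uniqueness of the minimum of {x, y}, transitivity from a minimum of
   {x, y, z}. *)
have Ranti x y : R x y -> R y x -> x = y.
  move=> Rxy Ryx; have Rxx : R x x by case: (Rtot x x).
  have Ryy : R y y by case: (Rtot y y).
  have [|z [_ zu]] := Rwo (fun z => (z == x) || (z == y)).
    by exists x; rewrite unfold_in eqxx.
  transitivity z; [apply/esym|]; apply: zu; split; rewrite ?unfold_in ?eqxx ?orbT //;
    by move=> t /orP[/eqP->|/eqP->].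
have Rtrans x y z : R x y -> R y z -> R x z.
  move=> Rxy Ryz.
  have [|t [tP tmin]] := Rmin (fun t => [\/ t = x, t = y | t = z]).
    by exists x; constructor 1.
  have Rtx : R t x by apply: tmin; constructor 1.
  have Rty : R t y by apply: tmin; constructor 2.
  have Rtz : R t z by apply: tmin; constructor 3.
  case: tP => et; subst t => //.
    by rewrite (Ranti _ _ Rxy Rtx).
  by rewrite -(Ranti _ _ Ryz Rty).
exists (fun x y => R x y /\ x <> y); split.
- move=> A /Rmin[a [Aa amin]]; exists a; split=> // x Ax [Rxa xa].
  by apply: xa; apply: Ranti (amin x Ax).
- move=> x y; case: (EM (x = y)) => [->|xy]; first by constructor 2.
  case: (Rtot x y) => ?; [constructor 1|constructor 3]; split=> // /esym; exact: xy.
- by move=> x [].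
- move=> x y z [Rxy xy] [Ryz yz]; split; first exact: Rtrans Ryz.
  by move=> xz; subst z; apply: xy; apply: Ranti.
Qed.

(** * Linear spans and leading terms *)

Section LinearSpan.
Variables (K : fieldType) (V : lmodType K).
Implicit Types (W X Y S : V -> Prop) (v w : V).

Definition lspan S : V -> Prop :=
  fun v => forall W, lsubspace W -> subset_pts S W -> W v.

Lemma subset_pts_anti X Y : subset_pts X Y -> subset_pts Y X -> X = Y.
Proof. by move=> XY YX; apply/predeqP => v; split; [apply: XY|apply: YX]. Qed.

Lemma lspan_lsubspace S : lsubspace (lspan S).
Proof.
split=> [W [W0 _ _]|x y Sx Sy W WW SW|a x Sx W WW SW] //.
  by case: (WW) => _ WD _; apply: WD; [apply: Sx|apply: Sy].
by case: (WW) => _ _; apply; apply: Sx.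
Qed.

Lemma lspan_sub S : subset_pts S (lspan S).
Proof. by move=> v Sv W _; apply. Qed.

Lemma lspan_min S W : lsubspace W -> subset_pts S W -> subset_pts (lspan S) W.
Proof. by move=> WW SW v; apply. Qed.

Lemma lspanS S S' : subset_pts S S' -> subset_pts (lspan S) (lspan S').
Proof.
move=> SS; apply: lspan_min (lspan_lsubspace _) _ => v Sv.
by apply: lspan_sub; apply: SS.
Qed.

Lemma lsubspaceN W v : lsubspace W -> W v -> W (- v).
Proof. by case=> _ _ WZ Wv; rewrite -scaleN1r; apply: WZ. Qed.

Lemma lsubspaceB W v w : lsubspace W -> W v -> W w -> W (v - w).
Proof. by move=> WW Wv Ww; case: (WW) => _ WD _; apply: WD => //; apply: lsubspaceN. Qed.

Lemma lsubspace_sum W (I : Type) (r : seq I) (P : pred I) (E : I -> V) :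
  lsubspace W -> (forall i, P i -> W (E i)) -> W (\sum_(i <- r | P i) E i).
Proof. by case=> W0 WD _ WE; elim/big_ind: _. Qed.

Lemma lspanU1 S a x : lspan (fun v => S v \/ v = a) x ->
  exists y c, lspan S y /\ x = y + c *: a.
Proof.
have [S0 SD SZ] := lspan_lsubspace S.
apply: (lspan_min (W := fun x => exists y c, lspan S y /\ x = y + c *: a)).
  split=> [|u v [y [c [Sy ->]]] [z [d [Sz ->]]]|d u [y [c [Sy ->]]]].
  - by exists 0, 0; rewrite scale0r addr0.
  - by exists (y + z), (c + d); split; [apply: SD|rewrite scalerDl addrACA].
  - by exists (d *: y), (d * c); split; [apply: SZ|rewrite scalerDr scalerA].
move=> v [Sv|->]; first by exists v, 0; rewrite scale0r addr0; split=> //; apply: lspan_sub.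
by exists 0, 1; rewrite scale1r add0r.
Qed.

(** Freeness of a Hamel basis is stated for duplicate-free lists; this brings [lspan] to that
    form. *)
Lemma lspan_comb S x : lspan S x -> exists (s : seq V) (c : V -> K),
  [/\ uniq s, forall v, v \in s -> S v & x = \sum_(v <- s) c v *: v].
Proof.
apply: (lspan_min (W := fun x => exists (s : seq V) (c : V -> K),
  [/\ uniq s, forall v, v \in s -> S v & x = \sum_(v <- s) c v *: v])).
  split=> [|u v [s [c [us sS ->]]] [t [d [ut tS ->]]]|a u [s [c [us sS ->]]]].
  - by exists [::], (fun=> 0); rewrite big_nil.
  (* Coefficients are extended by 0, so that both sums run over the common list [undup (s ++ t)]. *)
  - pose m (r : seq V) (e : V -> K) := fun v => if v \in r then e v else 0.
    have ext r e (q : seq V) : uniq r -> uniq q -> {subset r <= q} ->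
        \sum_(v <- r) e v *: v = \sum_(v <- q) m r e v *: v.
      move=> ur uq rq.
      have rqP : perm_eq r [seq v <- q | v \in r].
        apply: uniq_perm; rewrite ?filter_uniq // => w.
        by rewrite mem_filter andb_idr // => /rq.
      rewrite (perm_big _ rqP) big_filter big_mkcond; apply: eq_bigr => w _.
      by rewrite /m; case: ifP => // _; rewrite scale0r.
    exists (undup (s ++ t)), (fun v => m s c v + m t d v); split.
    + exact: undup_uniq.
    + by move=> w; rewrite mem_undup mem_cat => /orP[/sS|/tS].
    + under [RHS]eq_bigr do rewrite scalerDl.
      rewrite big_split /= -!ext ?undup_uniq // => w wm;
        by rewrite mem_undup mem_cat wm ?orbT.
  - exists s, (fun v => a * c v); split=> //.
    by rewrite scaler_sumr; apply: eq_bigr => i _; rewrite scalerA.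
move=> v Sv; exists [:: v], (fun=> 1); rewrite big_seq1 scale1r; split=> //.
by move=> w; rewrite inE => /eqP ->.
Qed.

End LinearSpan.

Section LeadingTerms.
Variables (K : fieldType) (V : lmodType K) (lt : V -> V -> Prop) (B : V -> Prop).
Hypothesis lt_min : forall A : V -> Prop, (exists a, A a) ->
        exists a, A a /\ forall x, A x -> ~ lt x a.
Hypothesis lt_total : forall x y, [\/ lt x y, x = y | lt y x].
Hypothesis lt_irr : forall x, ~ lt x x.
Hypothesis lt_trans : forall x y z, lt x y -> lt y z -> lt x z.
Hypothesis B_indep : forall b, B b -> ~ lspan (fun x => B x /\ x <> b) b.
Hypothesis B_total : forall v, lspan B v.
Implicit Types (X W : V -> Prop) (v w b : V).

Let below b := lspan (fun x => B x /\ lt x b).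
Let upto b := lspan (fun x => B x /\ (lt x b \/ x = b)).

(** [b] is the largest basis element in the support of [v], expressed through spans instead of
    coordinates. *)
Definition lead v b := [/\ B b, upto b v & ~ below b v].

Definition has_lead X b := exists v, X v /\ lead v b.

(** Lying in the span up to a single element of [D] survives sums, as the larger of two elements
    serves both. This replaces the maximum of a finite support. *)
Lemma lspan_upto (D : V -> Prop) : (forall b, D b -> B b) ->
  forall v, lspan D v -> v = 0 \/ exists b, D b /\ upto b v.
Proof.
move=> DB.
apply: (@lspan_min _ _ D (fun v => v = 0 \/ exists b, D b /\ upto b v)); last first.
  move=> b Db; right; exists b; split=> //; apply: lspan_sub.
  by split; [apply: DB|right].
have mono b b' : lt b b' -> subset_pts (upto b) (upto b').
  move=> bb'; apply: lspanS => x [Bx [xb|xb]]; split=> //; left.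
    exact: lt_trans bb'.
  by rewrite xb.
split=> [|x y [->|[b [Db bx]]]|a x [->|[b [Db bx]]]]; first by left.
- by rewrite add0r.
- case=> [->|[b' [Db' b'y]]]; first by rewrite addr0; right; exists b.
  right; case: (lt_total b b') => [lbb'|ebb'|lb'b].
  + exists b'; split=> //; have [_ UD _] := lspan_lsubspace (fun x => B x /\ (lt x b' \/ x = b')).
    by apply: UD => //; apply: mono bx.
  + exists b; split=> //; have [_ UD _] := lspan_lsubspace (fun x => B x /\ (lt x b \/ x = b)).
    by apply: UD => //; rewrite ebb'.
  + exists b; split=> //; have [_ UD _] := lspan_lsubspace (fun x => B x /\ (lt x b \/ x = b)).
    by apply: UD => //; apply: mono b'y.
- by left; rewrite scaler0.
- right; exists b; split=> //.
  by have [_ _ UZ] := lspan_lsubspace (fun x => B x /\ (lt x b \/ x = b)); apply: UZ.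
Qed.

Lemma lead_exists v : v <> 0 -> exists b, lead v b.
Proof.
move=> v0; case: (@lspan_upto B _ v (B_total v)) => // ex.
have [b [[Bb bv] bmin]] := lt_min ex; exists b; split=> // /lspan_upto[].
- by move=> b' [].
- by [].
- by move=> [b' [[Bb' b'b] b'v]]; apply: (bmin b').
Qed.

Lemma below_lead b v : below b v -> v <> 0 -> exists b', lt b' b /\ lead v b'.
Proof.
move=> bv v0; have [b' bl] := lead_exists v0; exists b'; split=> //.
case: bl => Bb' b'v nb'v; case: (lt_total b' b) => // [ebb'|bb'].
  by case: nb'v; rewrite ebb'.
case: nb'v; apply: lspanS bv => x [Bx xb]; split=> //; exact: lt_trans bb'.
Qed.

Lemma lead_self b : B b -> lead b b.
Proof.
move=> Bb; split=> //; first by apply: lspan_sub; split=> //; right.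
move=> bb; apply: (B_indep Bb); apply: lspanS bb => x [Bx xb]; split=> // exb.
by subst x; apply: lt_irr xb.
Qed.

Lemma lead_addr v w b : lead v b -> below b w -> lead (v + w) b.
Proof.
move=> [Bb bv nbv] bw; split=> //.
  have [_ UD _] := lspan_lsubspace (fun x => B x /\ (lt x b \/ x = b)).
  by apply: UD => //; apply: lspanS bw => x [Bx xb]; split=> //; left.
move=> bvw; apply: nbv; rewrite -(addrK w v).
exact: lsubspaceB (lspan_lsubspace _) bvw bw.
Qed.

Lemma lead_below v b b' : lead v b -> lt b b' -> below b' v.
Proof.
move=> [_ bv _] bb'; apply: lspanS bv => x [Bx [xb|xb]]; split=> //.
  exact: lt_trans bb'.
by rewrite xb.
Qed.

(** One step of Gaussian elimination: modulo [below b] both vectors are multiples of [b], and that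
    of [w] is nonzero. *)
Lemma lead_elim v w b : lead v b -> lead w b -> exists c, below b (v - c *: w).
Proof.
have split_top x : upto b x -> exists y c, below b y /\ x = y + c *: b.
  move=> bx; apply: lspanU1; apply: lspanS bx => y [By [yb|->]]; last by right.
  by left.
move=> [Bb /split_top[y [c [Hy ->]]] _] [_ /split_top[z [d [Hz ->]]] nbw].
have [_ _ LZ] := lspan_lsubspace (fun x => B x /\ lt x b).
have d0 : d != 0 by apply/eqP => d0; apply: nbw; rewrite d0 scale0r addr0.
exists (c / d); rewrite scalerDr scalerA divfK //.
have -> : y + c *: b - ((c / d) *: z + c *: b) = y - (c / d) *: z.
  by rewrite opprD addrACA subrr addr0.
by apply: lsubspaceB (lspan_lsubspace _) Hy _; apply: LZ.
Qed.

(** Take [v] in [Y] outside [X] with the smallest possible lead [b]. If some [w] in [X] had lead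
    [b], then [v - c *: w] would lie in [Y] outside [X] with a smaller lead. *)
Lemma new_lead_exists X Y : lsubspace X -> lsubspace Y -> subset_pts X Y ->
  ~ subset_pts Y X -> exists b, has_lead Y b /\ ~ has_lead X b.
Proof.
move=> lX lY XY nYX.
have [b [[v [Yv [nXv vb]]] bmin]] :
    exists b, (exists v, Y v /\ ~ X v /\ lead v b) /\
      forall b', (exists v, Y v /\ ~ X v /\ lead v b') -> ~ lt b' b.
  apply: lt_min; apply: contrapT => nex; apply: nYX => v Yv; apply: contrapT => nXv.
  have [|b vb] := @lead_exists v.
    by move=> v0; apply: nXv; rewrite v0; case: lX.
  by apply: nex; exists b; exists v.
exists b; split; first by exists v.
move=> [w [Xw wb]]; have [c bc] := lead_elim vb wb.
have Xcw : X (c *: w) by case: lX => _ _; apply.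
have nX : ~ X (v - c *: w).
  by move=> H; apply: nXv; rewrite -(subrK (c *: w) v); case: lX => _ XD _; apply: XD.
have [|b' [b'b lb']] := below_lead bc.
  by move=> e; apply: nX; rewrite e; case: lX.
apply: (bmin b') => //; exists (v - c *: w); split=> //.
by apply: lsubspaceB => //; apply: XY.
Qed.

(** Of two new leads let [b] be the smaller and [b'] the larger. A vector [v] of lead [b] involves
    [a], so a multiple of [v] clears [a] from a vector of lead [b']. The lead [b'] survives, and the
    result lies in [X]. *)
Lemma new_lead_unique X Y a b1 b2 : lsubspace X ->
  (forall v, Y v -> exists y c, X y /\ v = y + c *: a) ->
  has_lead Y b1 -> ~ has_lead X b1 -> has_lead Y b2 -> ~ has_lead X b2 -> b1 = b2.
Proof.
move=> lX YXa.
suff hyp b b' : has_lead Y b -> ~ has_lead X b -> has_lead Y b' ->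
    ~ has_lead X b' -> ~ lt b b'.
  by move=> *; case: (lt_total b1 b2) => // /hyp; case.
move=> [v [/YXa[y [c [Xy ev]]] vb]] nb [v' [/YXa[y' [c' [Xy' ev']]] v'b']] nb' bb'.
have c0 : c != 0.
  by apply/eqP => c0; apply: nb; exists v; rewrite {1}ev c0 scale0r addr0.
apply: nb'; exists (v' + (- (c' / c)) *: v); split; last first.
  apply: lead_addr => //; case: (lspan_lsubspace (fun x => B x /\ lt x b')) => _ _; apply.
  exact: lead_below bb'.
rewrite ev ev' scalerDr scalerA mulNr divfK // addrACA scaleNr (scaleNr c') subrr addr0.
by apply: lsubspaceB => //; case: lX => _ _; apply.
Qed.

(** Each further generator creates at most one new lead. *)
Lemma has_lead_fin (s : seq V) :
  exists t : seq V, forall b, has_lead (lspan [in s]) b -> b \in t.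
Proof.
elim: s => [|a s [t tP]].
  exists [::] => b [v [sv [_ _ nbv]]]; case: nbv.
  by apply: lspanS sv => x.
have sub v : lspan [in a :: s] v -> exists y c, lspan [in s] y /\ v = y + c *: a.
  move=> sv; apply: lspanU1; apply: lspanS sv => x.
  by rewrite inE => /orP[/eqP ->|xs]; [right|left].
case: (EM (exists b, has_lead (lspan [in a :: s]) b /\ ~ has_lead (lspan [in s]) b)).
  move=> [b0 [b0a nb0]]; exists (b0 :: t) => b ba; rewrite inE.
  case: (EM (has_lead (lspan [in s]) b)) => [/tP->|nb]; first by rewrite orbT.
  by rewrite (new_lead_unique (lspan_lsubspace _) sub ba nb b0a nb0) eqxx.
move=> nex; exists t => b ba; apply: tP; apply: contrapT => nb.
by apply: nex; exists b.
Qed.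

End LeadingTerms.

(** * Well ordered chains of linear subspaces *)

(** With [N := nice F] this is [wo_chain F] by conversion; a general [N] also covers families of
    linear subspaces. *)
Definition wo_chain_in (K : fieldType) (V : lmodType K)
    (N C : (V -> Prop) -> Prop) : Prop :=
  ((forall X, C X -> N X) /\
   (forall X Y, C X -> C Y -> subset_pts X Y \/ subset_pts Y X)) /\
  (forall D : (V -> Prop) -> Prop, (forall X, D X -> C X) -> (exists X, D X) ->
     exists X, D X /\ forall Y, D Y -> subset_pts X Y).

Definition max_wo_chain_in (K : fieldType) (V : lmodType K)
    (N C : (V -> Prop) -> Prop) : Prop :=
  wo_chain_in N C /\
  (forall C', wo_chain_in N C' -> (forall X, C X -> C' X) -> forall X, C' X -> C X).

Section LinearChains.
Variables (K : fieldType) (V : lmodType K) (good : (V -> Prop) -> Prop).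
Hypothesis good_lsub : forall W, good W -> lsubspace W.
Hypothesis good_up :
  forall W W', good W -> lsubspace W' -> subset_pts W W' -> good W'.
Hypothesis good_total : good (fun=> True).
(** For frames this is the span of a frame contained in [W]. It provides a finitely generated bottom
    below which no good subspace can be added. *)
Hypothesis good_min : forall W, good W -> exists s : seq V,
  [/\ good (lspan [in s]), subset_pts (lspan [in s]) W
    & forall W', good W' -> subset_pts W' (lspan [in s]) ->
                 subset_pts (lspan [in s]) W'].
Implicit Types (W X Y Z : V -> Prop) (C : (V -> Prop) -> Prop).

Lemma wo_chain_add C W : wo_chain_in good C -> good W ->
  (forall X, C X -> subset_pts X W \/ subset_pts W X) ->
  wo_chain_in good (fun X => C X \/ X = W).
Proof.
move=> [[Cg Cch] Cwo] gW cmp; split; first split.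
- by move=> X [/Cg//|->].
- move=> X Y [CX|->] [CY|->]; [exact: Cch|exact: cmp| |by left].
  by case: (cmp Y CY); [right|left].
- move=> D DC [X0 DX0].
  case: (EM (exists X, C X /\ D X)) => [[X1 [CX1 DX1]]|nex].
    have [||X [[CX DX] Xmin]] := Cwo (fun X => C X /\ D X); first by move=> X [].
      by exists X1.
    case: (EM (D W)) => [DW|nDW].
      case: (cmp X CX) => [XW|WX].
        by exists X; split=> // Y DY; case: (DC Y DY) => [CY|->//]; apply: Xmin.
      exists W; split=> // Y DY; case: (DC Y DY) => [CY|->//] v Wv.
      by apply: (Xmin Y (conj CY DY)); apply: WX.
    exists X; split=> // Y DY; case: (DC Y DY) => [CY|eY]; first exact: Xmin.
    by case: nDW; rewrite -eY.
  have DW Y : D Y -> Y = W.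
    by move=> DY; case: (DC Y DY) => // CY; case: nex; exists Y.
  by exists X0; split=> // Y /DW ->; rewrite (DW _ DX0).
Qed.

Lemma max_wo_chain_mem C W : max_wo_chain_in good C -> good W ->
  (forall X, C X -> subset_pts X W \/ subset_pts W X) -> C W.
Proof.
move=> [Cwo Cmax] gW cmp.
by apply: (Cmax _ (wo_chain_add Cwo gW cmp)); [left|right].
Qed.

(** [Y] is the immediate successor of [X] in [C]; the last clause excludes members strictly between
    them. *)
Definition covers C X Y := [/\ C X, C Y, subset_pts X Y, ~ subset_pts Y X
  & forall Z, C Z -> subset_pts Z X \/ subset_pts Y Z].

Lemma cover_exists C X : wo_chain_in good C -> C X ->
  (exists Z, C Z /\ ~ subset_pts Z X) -> exists Y, covers C X Y.
Proof.
move=> [[Cg Cch] Cwo] CX [Z [CZ nZX]].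
have [||Y [[CY nYX] Ymin]] := Cwo (fun Z => C Z /\ ~ subset_pts Z X).
- by move=> ? [].
- by exists Z.
exists Y; split=> //; first by case: (Cch X Y CX CY).
by move=> T CT; case: (EM (subset_pts T X)); [left|right; apply: Ymin].
Qed.

(** For [a] in [Y] outside [X], the sum of [X] and the line of [a] is comparable with every member.
    By maximality it belongs to [C], so it contains [Y]. *)
Lemma cover_dim1 C X Y : max_wo_chain_in good C -> covers C X Y ->
  exists a, forall v, Y v -> exists y c, X y /\ v = y + c *: a.
Proof.
move=> Cmax [CX CY XY nYX Ycov]; have [[[Cg Cch] Cwo] _] := Cmax.
have [a [Ya nXa]] : exists a, Y a /\ ~ X a.
  apply: contrapT => nex; apply: nYX => v Yv; apply: contrapT => nXv.
  by apply: nex; exists v.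
have [lX lY] := (good_lsub (Cg _ CX), good_lsub (Cg _ CY)).
pose Z := lspan (fun v => X v \/ v = a).
have XZ : subset_pts X Z by move=> v Xv; apply: lspan_sub; left.
have CZ : C Z.
  apply: max_wo_chain_mem => //.
    exact: good_up (Cg _ CX) (lspan_lsubspace _) XZ.
  move=> T CT; case: (Ycov T CT) => [TX|YT]; [by left => v /TX/XZ|right].
  apply: lspan_min; first exact: good_lsub (Cg _ CT).
  by move=> v [/XY/YT//|->]; apply: YT.
exists a => v Yv; have Zv : Z v.
  case: (Ycov Z CZ) => [ZX|YZ]; last exact: YZ.
  by case: nXa; apply: ZX; apply: lspan_sub; right.
have [y [c [Xy ev]]] := lspanU1 Zv; exists y, c; split=> //.
exact: lspan_min Xy.
Qed.

Lemma max_wo_chain_total C : max_wo_chain_in good C -> C (fun=> True).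
Proof. by move=> Cmax; apply: max_wo_chain_mem => // X _; left. Qed.

(** The least member contains a finitely generated good subspace; this lies below all of [C], so
    maximality puts it into [C]. *)
Lemma max_wo_chain_first C : max_wo_chain_in good C ->
  exists s : seq V, C (lspan [in s]) /\ forall X, C X -> subset_pts (lspan [in s]) X.
Proof.
move=> Cmax; have [[[Cg Cch] Cwo] _] := Cmax.
have [||X0 [CX0 X0min]] := Cwo C => //.
  by exists (fun=> True); apply: max_wo_chain_total.
have [s [gs sX0 _]] := good_min (Cg _ CX0).
have smin X : C X -> subset_pts (lspan [in s]) X.
  by move=> CX v /sX0; apply: X0min.
exists s; split=> //; apply: max_wo_chain_mem => // X CX; right; exact: smin.
Qed.

(** The union of the members not containing [Y] is good and comparable with all of [C], so it
    belongs to [C]. It misses [v], hence is not [Y], and is the immediate predecessor. *)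
Lemma max_wo_chain_pred C Y v : max_wo_chain_in good C -> C Y ->
  Y v -> (forall Z, C Z -> Z v -> subset_pts Y Z) ->
  (forall Z, C Z -> subset_pts Y Z) \/ exists X, covers C X Y /\ ~ X v.
Proof.
move=> Cmax CY Yv Ymin; have [[[Cg Cch] Cwo] _] := Cmax.
case: (EM (forall Z, C Z -> subset_pts Y Z)) => [|nY]; first by left.
right; have [Z0 [CZ0 nYZ0]] : exists Z, C Z /\ ~ subset_pts Y Z.
  apply: contrapT => nex; apply: nY => Z CZ; apply: contrapT => nYZ.
  by apply: nex; exists Z.
pose X w := exists Z, [/\ C Z, ~ subset_pts Y Z & Z w].
have Z0X : subset_pts Z0 X by move=> w Z0w; exists Z0.
have lX : lsubspace X.
  split.
  - by exists Z0; split=> //; case: (good_lsub (Cg _ CZ0)).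
  - move=> x y [Z1 [CZ1 n1 Z1x]] [Z2 [CZ2 n2 Z2y]].
    case: (Cch _ _ CZ1 CZ2) => [Z12|Z21].
      exists Z2; split=> //; case: (good_lsub (Cg _ CZ2)) => _ ZD _.
      by apply: ZD => //; apply: Z12.
    exists Z1; split=> //; case: (good_lsub (Cg _ CZ1)) => _ ZD _.
    by apply: ZD => //; apply: Z21.
  - move=> a x [Z1 [CZ1 n1 Z1x]]; exists Z1; split=> //.
    by case: (good_lsub (Cg _ CZ1)) => _ _; apply.
have nXv : ~ X v by move=> [Z [CZ nYZ Zv]]; apply: nYZ; apply: Ymin.
have CX : C X.
  apply: max_wo_chain_mem => //; first exact: good_up (Cg _ CZ0) lX Z0X.
  move=> Z CZ; case: (EM (subset_pts Y Z)) => [YZ|nYZ].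
    right=> w [Z1 [CZ1 nYZ1 Z1w]]; apply: YZ.
    by case: (Cch _ _ CY CZ1) => // Z1Y; apply: Z1Y.
  by left=> w Zw; exists Z.
exists X; split=> //; split=> //.
- move=> w [Z [CZ nYZ Zw]]; case: (Cch _ _ CY CZ) => // ZY; exact: ZY.
- by move=> YX; apply: nXv; apply: YX.
- move=> Z CZ; case: (EM (subset_pts Y Z)) => [|nYZ]; [by right|left=> w Zw].
  by exists Z.
Qed.

Theorem max_wo_chain_card C (B : V -> Prop) :
  max_wo_chain_in good C ->
  (forall b, B b -> ~ lspan (fun x => B x /\ x <> b) b) ->
  (forall v, lspan B v) ->
  (forall s : seq V, exists b, B b /\ b \notin s) ->
  equipotent C B.
Proof.
move=> Cmax Bind Btot Binf; have [[[Cg Cch] Cwo] _] := Cmax.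
have [lt [ltmin lttot ltirr lttr]] := strict_well_order V.
pose ld := has_lead lt B.
have ldS X Y b : subset_pts X Y -> ld X b -> ld Y b.
  by move=> XY [v [Xv vb]]; exists v; split=> //; apply: XY.
have [s [Cs smin]] := max_wo_chain_first Cmax.
have [t tP] := has_lead_fin B lttot lttr s.
pose top : V -> Prop := fun=> True.
have Ctop : C top := max_wo_chain_total Cmax.
(* Steps are indexed by their lower ends, that is, by all members except the top one; they are
   matched with the leads that the first member lacks. *)
pose C1 X := C X /\ X <> top.
pose S b := B b /\ ~ ld (lspan [in s]) b.
have covC1 X : C1 X -> exists Y, covers C X Y.
  move=> [CX Xtop]; apply: cover_exists => //; exists top; split=> // TX.
  by apply: Xtop; apply: subset_pts_anti.
pose phi X b := exists Y, [/\ covers C X Y, ld Y b & ~ ld X b].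
have C1S : equipotent C1 S.
  apply: (@equipotent_rel _ _ _ _ phi).
  - move=> X C1X; have [CX _] := C1X; have [Y cov] := covC1 X C1X.
    have [_ CY XY nYX _] := cov.
    have [b [Yb nXb]] := new_lead_exists ltmin lttot lttr Btot
      (good_lsub (Cg _ CX)) (good_lsub (Cg _ CY)) XY nYX.
    exists b; split; last by exists Y.
    split; first by case: Yb => v [_ []].
    by move/(ldS _ _ _ (smin _ CX)).
  - move=> b [Bb nsb].
    have [||Y [[CY Yb] Ymin]] := Cwo (fun Y => C Y /\ ld Y b).
    + by move=> Y [].
    + exists top; split=> //; exists b; split=> //; exact: lead_self.
    have [v [Yv vb]] := Yb.
    (* A member containing [v] has lead [b], so [Y] is also the least member containing [v]; its
       predecessor is the step that adds [b]. *)
    have [||YC|[X [cov nXv]]] := max_wo_chain_pred (v := v) Cmax CY => //.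
    + by move=> Z CZ Zv; apply: Ymin; split=> //; exists v.
    + by case: nsb; apply: ldS Yb; apply: YC.
    have [CX _ XY nYX _] := cov.
    exists X; split; last first.
      by exists Y; split=> // Xb; apply: nYX; apply: Ymin.
    by split=> // eX; apply: nXv; rewrite eX.
  - move=> X b b' [CX _] _ _ [Y [cov Yb nXb]] [Y' [cov' Y'b' nXb']].
    have eY : Y = Y'.
      case: cov cov' => [_ CY XY nYX Ycov] [_ CY' XY' nYX' Ycov'].
      apply: subset_pts_anti; first by case: (Ycov Y' CY').
      by case: (Ycov' Y CY).
    subst Y'; have [a Ya] := cover_dim1 Cmax cov.
    exact: (new_lead_unique lttot lttr (good_lsub (Cg _ CX)) Ya Yb nXb Y'b' nXb').
  - move=> X X' b [CX _] [CX' _] _.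
    suff hyp Z Z' : phi Z b -> phi Z' b -> subset_pts Z' Z.
      by move=> h h'; apply: subset_pts_anti; apply: hyp.
    move=> [Y [[_ _ _ _ Ycov] Yb nZb]] [Y' [[CZ' _ _ _ _] Y'b nZ'b]].
    by case: (Ycov _ CZ') => // YZ'; case: nZ'b; apply: ldS Yb.
(* [t] only bounds the leads of the first member; filtering by [B] makes the union of [S] and [t']
   exactly [B]. *)
pose t' := [seq b <- t | `[< B b >]].
have infS : dedekind_infinite S.
  apply: dedekind_infiniteP => r; have [b [Bb]] := Binf (r ++ t).
  rewrite mem_cat negb_or => /andP[br bt]; exists b; split=> //; split=> //.
  by move=> /tP bt'; rewrite bt' in bt.
have infC1 : dedekind_infinite C1.
  exact: dedekind_infinite_equipotent (equipotent_sym C1S) infS.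
have CC1 : equipotent C C1.
  apply: equipotent_trans (equipotent_add1 top infC1); apply: eq_equipotent => X.
  split=> [CX|[[]//|->]//].
  by case: (EM (X = top)); [right|left].
apply: equipotent_trans CC1 _; apply: equipotent_trans C1S _.
apply: equipotent_trans (equipotent_sym (equipotent_add_seq t' infS)) _.
apply: eq_equipotent => b; split=> [[[]//|]|Bb].
  by rewrite mem_filter => /andP[/asboolP].
case: (EM (ld (lspan [in s]) b)) => [/tP bt|nb]; [right|by left].
by rewrite mem_filter bt andbT; apply/asboolP.
Qed.


(* A well ordering of V refining the filtration by C makes every member of C an
   initial segment; the spans of all initial segments form the extension. *)
Theorem wo_chain_extend C : wo_chain_in good C ->
  exists C', max_wo_chain_in good C' /\ (forall X, C X -> C' X).
Proof.
move=> Cwo0; pose top : V -> Prop := fun=> True.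
have C1wo : wo_chain_in good (fun X => C X \/ X = top).
  by apply: wo_chain_add => // X _; left.
have [||X0 [C1X0 X0min]] := (C1wo.2) (fun X => C X \/ X = top) => //.
  by exists top; right.
have [s [gs sX0 smin]] := good_min (C1wo.1.1 _ C1X0).
pose H := lspan [in s].
pose C2 X := (C X \/ X = top) \/ X = H.
have C2wo : wo_chain_in good C2.
  apply: wo_chain_add => // X C1X; right=> v /sX0; exact: X0min.
have HC2 X : C2 X -> subset_pts H X.
  by move=> [C1X|->] // v /sX0; apply: X0min.
have [[C2g C2ch] C2min] := C2wo.
have C2top : C2 top by left; right.
have [lt [ltmin lttot _ _]] := strict_well_order V.
(* Vectors of smaller members come first; vectors lying in the same members are ordered by [lt]. *)
pose ltl v w := (exists X, [/\ C2 X, X v & ~ X w]) \/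
  ((forall X, C2 X -> (X v <-> X w)) /\ lt v w).
have ltl_total v w : [\/ ltl v w, v = w | ltl w v].
  case: (EM (exists X, [/\ C2 X, X v & ~ X w])) => [|n1].
    by move=> h; constructor 1; left.
  case: (EM (exists X, [/\ C2 X, X w & ~ X v])) => [|n2].
    by move=> h; constructor 3; left.
  have same X : C2 X -> (X v <-> X w).
    move=> C2X; split=> [Xv|Xw]; apply: contrapT => nX; [apply: n1|apply: n2];
      by exists X.
  case: (lttot v w) => [vw|vw|wv]; [constructor 1; right|by constructor 2|constructor 3; right].
    by split.
  by split=> // X C2X; split=> /(same _ C2X).
have ltl_min (A : V -> Prop) : (exists a, A a) -> exists a, A a /\ forall x, A x -> ~ ltl x a.
  move=> [a0 Aa0].
  have [||X [[C2X [a1 [Aa1 Xa1]]] Xmin]] := C2min (fun X => C2 X /\ exists a, A a /\ X a).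
  - by move=> X [].
  - by exists top; split=> //; exists a0.
  have [|a [[Aa Xa] amin]] := ltmin (fun a => A a /\ X a); first by exists a1.
  exists a; split=> // x Ax [[Y [C2Y Yx nYa]]|[same xa]].
    by apply: nYa; apply: Xmin Xa; split=> //; exists x.
  by apply: (amin x) xa; split=> //; apply/(same X C2X).
pose init (I : V -> Prop) := forall v w, I w -> ltl v w -> I v.
have init_total I J : init I -> init J -> subset_pts I J \/ subset_pts J I.
  move=> iI iJ; case: (EM (subset_pts I J)) => [|nIJ]; first by left.
  right=> y Jy; apply: contrapT => nIy; apply: nIJ => x Ix.
  case: (ltl_total x y) => [xy|->//|yx]; first exact: iJ xy.
  by case: nIy; apply: iI yx.
have C2init X : C2 X -> init X.
  move=> C2X v w Xw [[Y [C2Y Yv nYw]]|[same _]]; last exact/(same X C2X).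
  by case: (C2ch X Y C2X C2Y) => [XY|YX]; [case: nYw; apply: XY|apply: YX].
(* [H] is adjoined because a short initial segment need not span a good subspace. *)
pose span I := lspan (fun v => H v \/ I v).
pose D W := exists I, init I /\ W = span I.
have spanS I J : subset_pts I J -> subset_pts (span I) (span J).
  by move=> IJ; apply: lspanS => v [Hv|/IJ]; [left|right].
have Hspan I : subset_pts H (span I) by move=> v Hv; apply: lspan_sub; left.
have C2D X : C2 X -> D X.
  move=> C2X; exists X; split; first exact: C2init.
  apply: subset_pts_anti; first by move=> v Xv; apply: lspan_sub; right.
  by apply: lspan_min; [apply: good_lsub (C2g _ C2X)|move=> v [/(HC2 _ C2X)|]].
have Dwo : wo_chain_in good D.
  split; first split.
  - by move=> W [I [_ ->]]; apply: good_up gs (lspan_lsubspace _) (Hspan I).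
  - move=> W W' [I [iI ->]] [J [iJ ->]].
    by case: (init_total I J iI iJ) => /spanS; [left|right].
  - move=> E ED [W0 EW0]; have [I0 [iI0 eW0]] := ED _ EW0.
    (* The least member of [E] is found through the first vector [a] of [I0] that some segment of
       [E] misses: every segment missing [a] lies inside all the others. If there is no such [a],
       then [W0] is least. *)
    pose bad a := I0 a /\ exists J, [/\ init J, E (span J) & ~ J a].
    case: (EM (exists a, bad a)) => [/ltl_min[a [[I0a [J [iJ EJ nJa]]] amin]]|nbad].
      exists (span J); split=> // W EW; have [L [iL eW]] := ED _ EW.
      rewrite eW; apply: spanS => x Jx; apply: contrapT => nLx.
      have I0x : I0 x.
        by case: (init_total I0 J iI0 iJ) => [sub|]; [case: nJa; apply: sub|apply].
      have : bad x by split=> //; exists L; rewrite -eW.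
      move/amin => nxa; case: (ltl_total x a) => // [exa|ax].
        by apply: nJa; rewrite -exa.
      by apply: nJa; apply: iJ ax.
    exists W0; split=> // W EW; have [L [iL eW]] := ED _ EW.
    rewrite eW0 eW; apply: spanS => x I0x; apply: contrapT => nLx.
    by apply: nbad; exists x; split=> //; exists L; rewrite -eW.
exists D; split; last by move=> X CX; apply: C2D; left; left.
split=> // C' [[C'g C'ch] _] DC' Y C'Y.
have HY : subset_pts H Y.
  have C'H : C' H by apply: DC'; apply: C2D; right.
  by case: (C'ch H Y C'H C'Y) => // YH; apply: smin => //; apply: C'g.
(* [I] is the largest initial segment inside [Y], and the claim is that [Y] is its span. Otherwise
   let [a] be the first vector outside [I]; then [a] is not in [Y], so comparability traps [Y]
   between [span I] and [span Ia], where there is no room. *)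
pose I v := exists J, [/\ init J, subset_pts J Y & J v].
have iI : init I.
  by move=> v w [J [iJ JY Jw]] vw; exists J; split=> //; apply: iJ vw.
have lY := good_lsub (C'g _ C'Y).
have IY : subset_pts (span I) Y.
  by apply: lspan_min => // v [/HY//|[J [_ JY /JY]]].
exists I; split=> //; apply: subset_pts_anti => // v Yv; apply: contrapT => nIv.
have [|a [nIa amin]] := ltl_min (fun x => ~ I x).
  by exists v => Iv; apply: nIv; apply: lspan_sub; right.
pose Ia x := I x \/ x = a.
have iIa : init Ia.
  move=> x y [Iy|->] xy; first by left; apply: iI xy.
  by left; apply: contrapT => nIx; apply: (amin x).
have nYa : ~ Y a.
  move=> Ya; apply: nIa; exists Ia; split=> //; last by right.
  by move=> x [Ix|->//]; apply: IY; apply: lspan_sub; right.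
have C'Ia : C' (span Ia) by apply: DC'; exists Ia.
case: (C'ch _ _ C'Ia C'Y) => [sub|sub].
  by apply: nYa; apply: sub; apply: lspan_sub; right; right.
have [|y [c [Iy ev]]] := @lspanU1 _ _ (fun x => H x \/ I x) a v.
  by apply: lspanS (sub _ Yv) => x [Hx|[Ix|->]]; [left; left|left; right|right].
have [c0|c0] := eqVneq c 0.
  by apply: nIv; rewrite ev c0 scale0r addr0.
apply: nYa; have -> : a = c^-1 *: (v - y).
  by rewrite ev addrC addKr scalerA mulVf // scale1r.
case: (lY) => _ _; apply; apply: lsubspaceB => //; exact: IY.
Qed.

End LinearChains.

(** * Hermitian and quadratic forms *)

(* What the Hermitian and quadratic cases have in common: Q is f(x,x) or q(x),
   T is the trace a + s(a) or the identity, and form_hilbert90 is the additive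
   Hilbert 90 for the involution s (trivial in the quadratic case). *)
Record form_data (K : fieldType) (V : lmodType K) (F : pform V) := FormData {
  form_s : {rmorphism K -> K};
  form_Q : V -> K;
  form_T : K -> K;
  form_sK : forall a, form_s (form_s a) = a;
  bilDl : forall x y z, bil F (x + y) z = bil F x z + bil F y z;
  bilZl : forall a x y, bil F (a *: x) y = a * bil F x y;
  bilC : forall x y, bil F y x = form_s (bil F x y);
  form_QD : forall x y, form_Q (x + y) = form_Q x + form_Q y + form_T (bil F x y);
  form_QZ : forall a x, form_Q (a *: x) = a * form_s a * form_Q x;
  form_TD : forall a b, form_T (a + b) = form_T a + form_T b;
  form_T_onto : forall x, exists a, form_T a = form_Q x;
  form_hilbert90 : forall a, form_T a = 0 -> exists g, a = g - form_s g;
  form_singular : forall x, singular F x <-> form_Q x = 0;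
  bil_singular : forall x, singular F x -> bil F x x = 0
}.

Lemma nondeg_form_data (K : fieldType) (V : lmodType K) (F : pform V) :
  nondeg_form F -> inhabited (form_data F).
Proof.
case: F => [s f [[sD sM s1 sK [x0 sx0]] [fD fZ fC] _]|q [[qZ pD pZ pC] _]]; last first.
  exists; apply: (@FormData _ _ (Quad q) idfun q id) => //=.
  - by move=> x y; rewrite /polar; ring.
  - by move=> x; exists (q x).
  - by move=> a ->; exists 0; rewrite subr0.
  - move=> x qx; rewrite /polar -[x + x]/(x *+ 2) -scaler_nat qZ qx.
    by rewrite mulr0 !subr0.
have s0 : s 0 = 0 by apply: (addrI (s 0)); rewrite -sD !addr0.
have sN a : s (- a) = - s a.
  by apply: (addrI (s a)); rewrite -sD !subrr.
have sB : {morph s : a b / a - b} by move=> a b; rewrite sD sN.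
pose sr : {rmorphism K -> K} := HB.pack s
  (GRing.isZmodMorphism.Build K K s sB) (GRing.isMonoidMorphism.Build K K s (s1, sM)).
(* An element of nonzero trace: 1 unless the characteristic is 2, when any element moved by [s] will
   do. *)
have [w w0] : exists w, w + s w != 0.
  case: (eqVneq (1 + 1 : K) 0) => [two0|two]; last by exists 1; rewrite s1.
  exists x0; apply/eqP => e; apply: sx0.
  have e2 : x0 + x0 = 0 by rewrite -[x0]mul1r -mulrDl two0 mul0r.
  by apply: (addrI x0); rewrite e e2.
have sV a : s a^-1 = (s a)^-1 by exact: (fmorphV sr a).
have sW : s (w + s w) = w + s w by rewrite sD sK addrC.
exists; apply: (@FormData _ _ (Herm s f) sr (fun x => f x x) (fun a => a + s a)) => //=.
- have fDr x y z : f z (x + y) = f z x + f z y by rewrite fC fD sD -!fC.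
  by move=> x y; rewrite fD !fDr (fC x y); ring.
- by move=> a x; rewrite fZ (fC (a *: x)) fZ sM -fC; ring.
- by move=> a b; rewrite sD; ring.
- move=> x; exists (f x x * w / (w + s w)).
  by rewrite !sM sV sW -(fC x x) -mulrDl -mulrDr mulfK.
- move=> a ta; have {ta} sa : s a = - a by apply: (addrI a); rewrite ta subrr.
  (* Since [s a = - a] and [w + s w] is fixed by [s], subtracting the conjugate gives
     [a * (w + s w) / (w + s w)]. *)
  exists (a * w / (w + s w)).
  by rewrite !sM sV sW sa -mulrBl mulNr opprK -mulrDr mulfK.
Qed.

Section Form.
Variables (K : fieldType) (V : lmodType K) (F : pform V) (d : form_data F).
Notation s := (form_s d).
Notation Q := (form_Q d).
Notation T := (form_T d).
Notation h := (bil F).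
Implicit Types (X Y M W U : V -> Prop) (x y u v : V).

Lemma bilDr z x y : h z (x + y) = h z x + h z y.
Proof. by rewrite (bilC d) (bilDl d) rmorphD /= -!(bilC d). Qed.

Lemma bilZr a x y : h x (a *: y) = s a * h x y.
Proof. by rewrite (bilC d) (bilZl d) rmorphM /= -(bilC d). Qed.

Lemma bil0l x : h 0 x = 0.
Proof. by rewrite -(scale0r 0) (bilZl d) mul0r. Qed.

Lemma bil0r x : h x 0 = 0.
Proof. by rewrite (bilC d) bil0l rmorph0. Qed.

Lemma bilNr x y : h x (- y) = - h x y.
Proof. by rewrite -scaleN1r bilZr rmorphN1 mulN1r. Qed.

Lemma bilNl x y : h (- x) y = - h x y.
Proof. by rewrite -scaleN1r (bilZl d) mulN1r. Qed.

Lemma bil_suml (I : Type) (r : seq I) (P : pred I) (E : I -> V) x :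
  h (\sum_(i <- r | P i) E i) x = \sum_(i <- r | P i) h (E i) x.
Proof. by apply: (big_morph (h^~ x)) => [u v|]; rewrite ?(bilDl d) ?bil0l. Qed.

Lemma bil_sumr (I : Type) (r : seq I) (P : pred I) (E : I -> V) x :
  h x (\sum_(i <- r | P i) E i) = \sum_(i <- r | P i) h x (E i).
Proof. by apply: (big_morph (h x)) => [u v|]; rewrite ?bilDr ?bil0r. Qed.

Lemma bil_orthC x y : h x y = 0 -> h y x = 0.
Proof. by move=> xy; rewrite (bilC d) xy rmorph0. Qed.

Lemma form_T0 : T 0 = 0.
Proof. by apply: (addrI (T 0)); rewrite -(form_TD d) !addr0. Qed.

Lemma form_TN a : T (- a) = - T a.
Proof. by apply: (addrI (T a)); rewrite -(form_TD d) !subrr form_T0. Qed.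

Lemma form_Q0 : Q 0 = 0.
Proof. by rewrite -(scale0r 0) (form_QZ d) !mul0r. Qed.

Lemma singular0 : singular F 0.
Proof. by apply/(form_singular d); rewrite form_Q0. Qed.

Lemma singularD x y : singular F x -> singular F y -> h x y = 0 ->
  singular F (x + y).
Proof.
move=> /(form_singular d) Qx /(form_singular d) Qy xy; apply/(form_singular d).
by rewrite (form_QD d) Qx Qy xy form_T0 !addr0.
Qed.

Lemma singularZ a x : singular F x -> singular F (a *: x).
Proof.
by move=> /(form_singular d) Qx; apply/(form_singular d); rewrite (form_QZ d) Qx mulr0.
Qed.

Lemma singular_orthD x u : singular F x -> h x u = 0 ->
  singular F (x + u) -> singular F u.
Proof.
move=> /(form_singular d) Qx xu /(form_singular d).
by rewrite (form_QD d) Qx xu form_T0 add0r addr0 => ?; apply/(form_singular d).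
Qed.

Lemma perp_lsubspace (I : Type) (g : I -> V) :
  lsubspace (fun x => forall i, h x (g i) = 0).
Proof.
split=> [i|x y xg yg i|a x xg i]; first exact: bil0l.
  by rewrite (bilDl d) xg yg addr0.
by rewrite (bilZl d) xg mulr0.
Qed.

Definition points W : V -> Prop := fun v => W v /\ is_point F v.

(** Sets of points omit 0; adjoining it makes scaling and collinear addition free of nonvanishing
    conditions. *)
Definition with_zero X : V -> Prop := fun v => v = 0 \/ X v.

Lemma points_subspace W : lsubspace W -> subspace F (points W).
Proof.
move=> [W0 WD WZ]; split; first split.
- by move=> v [].
- move=> a v a0 [Wv [v0 sv]]; split; first exact: WZ.
  split; last exact: singularZ.
  by move/eqP; rewrite scaler_eq0 (negPf a0) => /eqP.
- move=> u v [Wu _] [Wv _] _ [su sv uv] a b ab0; split.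
    by apply: WD; apply: WZ.
  split=> //; apply: singularD; try exact: singularZ.
  by rewrite (bilZl d) bilZr uv !mulr0.
Qed.

Lemma points_sing_subspace W : lsubspace W -> (forall v, W v -> singular F v) ->
  (forall u v, W u -> W v -> h u v = 0) -> sing_subspace F (points W).
Proof.
move=> lW Ws Wh; split; first exact: points_subspace.
by move=> u v [Wu _] [Wv _]; split; [apply: Ws|apply: Ws|apply: Wh].
Qed.

Section Subspace.
Variable X : V -> Prop.
Hypothesis subX : subspace F X.

Lemma with_zero_singular v : with_zero X v -> singular F v.
Proof. by case=> [->|Xv]; [exact: singular0|case: subX => -[/(_ v Xv)[]]]. Qed.

Lemma with_zeroZ a v : with_zero X v -> with_zero X (a *: v).
Proof.
case=> [->|Xv]; first by left; rewrite scaler0.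
case: (eqVneq a 0) => [->|a0]; first by left; rewrite scale0r.
by right; case: subX => -[_ XZ] _; apply: XZ.
Qed.

Lemma with_zeroD u v : with_zero X u -> with_zero X v -> h u v = 0 ->
  with_zero X (u + v).
Proof.
case=> [->|Xu]; first by rewrite add0r.
case=> [->|Xv] uv; first by rewrite addr0; right.
have [[Xpt XZ] Xline] := subX.
have [[u0 su] [v0 sv]] := (Xpt _ Xu, Xpt _ Xv).
case: (EM (indep2 u v)) => [ind|nind].
  case: (eqVneq (u + v) 0) => [->|uv0]; first by left.
  right; rewrite -(scale1r u) -(scale1r v); apply: Xline => //.
  by rewrite !scale1r; apply/eqP.
suff [c ->] : exists c, v = c *: u.
  by rewrite -{1}(scale1r u) -scalerDl; apply: with_zeroZ; right.
apply: contrapT => nc; apply: nind => a b ab.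
have b0 : b = 0.
  apply/eqP; apply: contrapT => /negP b0; apply: nc; exists (- (b^-1 * a)).
  rewrite scaleNr -scalerA -[v](scalerK b0) -scalerN; congr (_ *: _).
  by apply/eqP; rewrite -addr_eq0 addrC ab.
split=> //; move: ab; rewrite b0 scale0r addr0 => /eqP.
by rewrite scaler_eq0 => /orP[/eqP|/eqP].
Qed.

End Subspace.

Lemma sing_subspace_lsubspace M : sing_subspace F M -> lsubspace (with_zero M).
Proof.
move=> [sM tM]; split; first by left.
- move=> x y Mx My; apply: with_zeroD => //.
  case: Mx My => [->|Mx]; first by rewrite bil0l.
  case=> [->|My]; first by rewrite bil0r.
  by case: (tM x y Mx My).
- by move=> a x; apply: with_zeroZ.
Qed.

(** Otherwise [M] and [v] would span a larger singular subspace. *)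
Lemma max_sing_subspace_perp M v : max_sing_subspace F M -> singular F v ->
  (forall m, M m -> h m v = 0) -> with_zero M v.
Proof.
move=> [sM Mmax] sv Mv; have lM := sing_subspace_lsubspace sM.
have [M0 MD MZ] := lM.
case: (eqVneq v 0) => [->|v0]; first by left.
right; pose W := lspan (fun x => with_zero M x \/ x = v).
have Wsplit x : W x -> exists m c, with_zero M m /\ x = m + c *: v.
  move=> /lspanU1[m [c [Mm ->]]]; exists m, c; split=> //.
  exact: lspan_min Mm.
have Msing m : with_zero M m -> singular F m.
  by case: sM => sM _; apply: with_zero_singular.
have Mh m : with_zero M m -> h m v = 0 by move=> [->|/Mv//]; rewrite bil0l.
have MM m m' : with_zero M m -> with_zero M m' -> h m m' = 0.
  case=> [->|Mm]; first by rewrite bil0l.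
  case=> [->|Mm']; first by rewrite bil0r.
  by case: sM => _ /(_ m m' Mm Mm')[].
have hvv := bil_singular d sv.
have sW : sing_subspace F (points W).
  apply: points_sing_subspace (lspan_lsubspace _) _ _.
    move=> x /Wsplit[m [c [Mm ->]]]; apply: singularD; [exact: Msing|exact: singularZ|].
    by rewrite bilZr Mh // mulr0.
  move=> x y /Wsplit[m [c [Mm ->]]] /Wsplit[m' [c' [Mm' ->]]].
  rewrite !(bilDl d) !bilDr !(bilZl d) !bilZr MM // Mh // (bil_orthC (Mh _ Mm')) hvv.
  by rewrite !mulr0 !addr0.
apply: (Mmax _ sW).
  move=> x Mx; split; first by apply: lspan_sub; left; right.
  by case: sM => -[[+ _] _] _; apply.
split; first by apply: lspan_sub; right.
by split=> //; apply/eqP.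
Qed.
End Form.

(** * Coordinates in a Witt decomposition *)

Section Combinations.
Variables (K : fieldType) (V : lmodType K) (n : nat).
Implicit Types (a b : 'rV[K]_n) (g : 'I_n -> V).

Definition comb g a : V := \sum_i a 0 i *: g i.

Lemma combD g a b : comb g (a + b) = comb g a + comb g b.
Proof. by rewrite -big_split; apply: eq_bigr => i _; rewrite mxE scalerDl. Qed.

Lemma combZ g c a : comb g (c *: a) = c *: comb g a.
Proof. by rewrite scaler_sumr; apply: eq_bigr => i _; rewrite mxE scalerA. Qed.

Lemma comb0 g : comb g 0 = 0.
Proof. by rewrite /comb big1 // => i _; rewrite mxE scale0r. Qed.

Lemma combB g a b : comb g (a - b) = comb g a - comb g b.
Proof. by rewrite -[- b]scaleN1r combD combZ scaleN1r. Qed.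

Lemma comb_delta g i : comb g (delta_mx 0 i) = g i.
Proof.
rewrite /comb (bigD1 i) //= mxE !eqxx scale1r big1 ?addr0 // => j ji.
by rewrite mxE (negPf ji) andbF scale0r.
Qed.

Lemma singular_comb (F : pform V) (d : form_data F) g a :
  (forall i, singular F (g i)) -> (forall i j, bil F (g i) (g j) = 0) ->
  singular F (comb g a).
Proof.
move=> gs gg; rewrite /comb; elim: (index_enum _) => [|i r IH].
  by rewrite big_nil; apply: (singular0 d).
rewrite big_cons; apply: (singularD d) => //; first exact: (singularZ d).
rewrite (bil_sumr d) big1 // => j _.
by rewrite (bilZr d) (bilZl d) gg !mulr0.
Qed.

End Combinations.

Section Witt.
Variables (K : fieldType) (V : lmodType K) (F : pform V) (d : form_data F).
Variables (n : nat) (e f : 'I_n -> V) (U : V -> Prop).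
Hypothesis wd : witt_decomposition F e f U.
Notation s := (form_s d).
Notation Q := (form_Q d).
Notation T := (form_T d).
Notation h := (bil F).
Implicit Types (a b : 'rV[K]_n) (u v x y : V).

Definition dot a b : K := \sum_i a 0 i * s (b 0 i).
Notation ec := (comb e).
Notation fc := (comb f).

Lemma witt_ee i j : h (e i) (e j) = 0.
Proof.
have [w1 w2 _ _] := wd; case: (eqVneq i j) => [->|/w2[]//].
by apply: (bil_singular d); case: (w1 j).
Qed.

Lemma witt_ff i j : h (f i) (f j) = 0.
Proof.
have [w1 w2 _ _] := wd; case: (eqVneq i j) => [->|/w2[]//].
by apply: (bil_singular d); case: (w1 j).
Qed.

Lemma witt_ef i j : h (e i) (f j) = (i == j)%:R.
Proof.
have [w1 w2 _ _] := wd; case: (eqVneq i j) => [->|/w2[]//].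
by case: (w1 j).
Qed.

Lemma witt_fe i j : h (f i) (e j) = (i == j)%:R.
Proof. by rewrite (bilC d) witt_ef rmorph_nat eq_sym. Qed.

Lemma witt_eU i u : U u -> h (e i) u = 0.
Proof. by have [_ _ _ [w _ _ _]] := wd => /(w i)[]. Qed.

Lemma witt_fU i u : U u -> h (f i) u = 0.
Proof. by have [_ _ _ [w _ _ _]] := wd => /(w i)[]. Qed.

Lemma witt_lsub : lsubspace U.
Proof. by case: wd. Qed.

Lemma witt_anis u : U u -> Q u = 0 -> u = 0.
Proof.
have [_ _ _ [_ w _ _]] := wd => Uu Qu; apply: w => //.
exact/(form_singular d).
Qed.

Lemma witt_ex v : exists a b u, U u /\ v = ec a + fc b + u.
Proof.
have [_ _ _ [_ _ w _]] := wd; have [a [b [u [Uu ->]]]] := w v.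
exists (\row_i a i), (\row_i b i), u; split=> //; congr (_ + _).
by rewrite -big_split; apply: eq_bigr => i _; rewrite !mxE.
Qed.

Lemma bil_comb_ef a b : h (ec a) (fc b) = dot a b.
Proof.
rewrite (bil_suml d); apply: eq_bigr => i _; rewrite (bilZl d) (bil_sumr d).
rewrite (bigD1 i) //= (bilZr d) witt_ef eqxx mulr1 big1 ?addr0 // => j ji.
by rewrite (bilZr d) witt_ef eq_sym (negPf ji) mulr0.
Qed.

Lemma bil_comb_fe a b : h (fc b) (ec a) = s (dot a b).
Proof. by rewrite (bilC d) bil_comb_ef. Qed.

Lemma bil_comb_ee a b : h (ec a) (ec b) = 0.
Proof.
rewrite (bil_suml d) big1 // => i _; rewrite (bil_sumr d) big1 // => j _.
by rewrite (bilZr d) (bilZl d) witt_ee !mulr0.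
Qed.

Lemma bil_comb_ff a b : h (fc a) (fc b) = 0.
Proof.
rewrite (bil_suml d) big1 // => i _; rewrite (bil_sumr d) big1 // => j _.
by rewrite (bilZr d) (bilZl d) witt_ff !mulr0.
Qed.

Lemma bil_comb_eU a u : U u -> h (ec a) u = 0.
Proof. by move=> Uu; rewrite (bil_suml d) big1 // => i _; rewrite (bilZl d) witt_eU ?mulr0. Qed.

Lemma bil_comb_fU a u : U u -> h (fc a) u = 0.
Proof. by move=> Uu; rewrite (bil_suml d) big1 // => i _; rewrite (bilZl d) witt_fU ?mulr0. Qed.

Lemma bil_comb_Ue a u : U u -> h u (ec a) = 0.
Proof. by move=> /(bil_comb_eU a)/(bil_orthC d). Qed.

Lemma bil_comb_Uf a u : U u -> h u (fc a) = 0.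
Proof. by move=> /(bil_comb_fU a)/(bil_orthC d). Qed.

Lemma singular_ec a : singular F (ec a).
Proof. by apply: (singular_comb d) witt_ee => i; case: wd => /(_ i)[]. Qed.

Lemma singular_fc a : singular F (fc a).
Proof. by apply: (singular_comb d) witt_ff => i; case: wd => /(_ i)[]. Qed.

(** For fixed [u], singularity constrains only [T (dot a b)]; the ambiguity left in [dot a b] is the
    kernel of [T], which [form_hilbert90] describes. *)
Lemma witt_Q a b u : U u -> Q (ec a + fc b + u) = T (dot a b) + Q u.
Proof.
move=> Uu; rewrite !(form_QD d) (bilDl d) bil_comb_ef bil_comb_eU // bil_comb_fU //.
have /(form_singular d) -> := singular_ec a.
have /(form_singular d) -> := singular_fc b.
by rewrite !addr0 (form_T0 d) !add0r addr0.
Qed.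

Lemma dot_deltar a i c : dot a (c *: delta_mx 0 i) = a 0 i * s c.
Proof.
rewrite /dot (bigD1 i) //= !mxE !eqxx mulr1 big1 ?addr0 // => j ji.
by rewrite !mxE (negPf ji) andbF mulr0 rmorph0 mulr0.
Qed.

Lemma dot_deltal b i c : dot (c *: delta_mx 0 i) b = c * s (b 0 i).
Proof.
rewrite /dot (bigD1 i) //= !mxE !eqxx mulr1 big1 ?addr0 // => j ji.
by rewrite !mxE (negPf ji) andbF mulr0 mul0r.
Qed.

Lemma dotDl a a' b : dot (a + a') b = dot a b + dot a' b.
Proof. by rewrite -big_split; apply: eq_bigr => i _; rewrite mxE mulrDl. Qed.

Lemma dotDr a b b' : dot a (b + b') = dot a b + dot a b'.
Proof. by rewrite -big_split; apply: eq_bigr => i _; rewrite mxE rmorphD mulrDr. Qed.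

Lemma witt_coordE a b u i : U u -> h (ec a + fc b + u) (f i) = a 0 i.
Proof.
move=> Uu; rewrite -(comb_delta f) !(bilDl d) bil_comb_ef bil_comb_ff bil_comb_Uf // !addr0.
by rewrite -[delta_mx 0 i]scale1r dot_deltar rmorph1 mulr1.
Qed.

Lemma witt_coordF a b u i : U u -> h (ec a + fc b + u) (e i) = b 0 i.
Proof.
move=> Uu; rewrite -(comb_delta e) !(bilDl d) bil_comb_ee bil_comb_fe bil_comb_Ue // add0r addr0.
by rewrite -[delta_mx 0 i]scale1r dot_deltal mul1r (form_sK d).
Qed.

Lemma witt_uniq a b u : U u -> ec a + fc b + u = 0 -> [/\ a = 0, b = 0 & u = 0].
Proof.
move=> Uu abu.
have a0 : a = 0 by apply/rowP => i; rewrite -(witt_coordE a b i Uu) abu (bil0l d) mxE.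
have b0 : b = 0 by apply/rowP => i; rewrite -(witt_coordF a b i Uu) abu (bil0l d) mxE.
by split=> //; move: abu; rewrite a0 b0 !comb0 !add0r.
Qed.

(* The e-coordinates of a totally singular family form a matrix A whose kernel
   consists of combinations lying in span f; these are orthogonal to the row
   space of A. *)
Lemma totally_singular_dim k (g : 'I_k -> V) : (forall i, singular F (g i)) ->
  (forall i j, h (g i) (g j) = 0) ->
  (forall c : 'rV[K]_k, comb g c = 0 -> c = 0) -> (k <= n)%N.
Proof.
move=> gs gg gfree.
have /choice[ab abP] : forall i, exists ab : 'rV[K]_n * 'rV[K]_n,
    U (g i - (ec ab.1 + fc ab.2)).
  move=> i; have [a [b [u [Uu ->]]]] := witt_ex (g i).
  by exists (a, b); rewrite /= addrC addKr.
pose A := \matrix_i (ab i).1; pose B := \matrix_i (ab i).2.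
have gE (c : 'rV_k) : exists u, U u /\
    comb g c = ec (c *m A) + fc (c *m B) + u.
  exists (\sum_i c 0 i *: (g i - (ec (ab i).1 + fc (ab i).2))); split.
    apply: lsubspace_sum witt_lsub _ => i _; case: witt_lsub => _ _; apply; exact: abP.
  have combM g0 (N : 'I_k -> 'rV[K]_n) :
      comb g0 (c *m \matrix_i N i) = \sum_i c 0 i *: comb g0 (N i).
    rewrite mulmx_sum_row.
    rewrite (big_morph (comb g0) (id1 := 0) (op1 := +%R)); first last.
    - exact: comb0.
    - exact: combD.
    by apply: eq_bigr => i _; rewrite rowK combZ.
  rewrite /A /B !combM -!big_split; apply: eq_bigr => i _ /=.
  by rewrite -!scalerDr addrC subrK.
have singc (c : 'rV_k) : singular F (comb g c) := singular_comb d c gs gg.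
(* Without e-coordinates the value of [Q] is that of the [U]-component, which therefore vanishes by
   anisotropy. *)
have kerE (c : 'rV_k) : c *m A = 0 -> comb g c = fc (c *m B).
  move=> cA; have [u [Uu E]] := gE c.
  move: (singc c); rewrite E cA comb0 add0r => /(form_singular d).
  rewrite -[fc _]add0r -(comb0 e) witt_Q // /dot big1 ?(form_T0 d) ?add0r.
    by move/(witt_anis Uu) ->; rewrite addr0.
  by move=> i _; rewrite mxE mul0r.
have orth : (kermx A *m B) *m (map_mx s A)^T = 0.
  apply/row_matrixP => i; rewrite row0 row_mul row_mul; apply/rowP => j.
  set c := row i (kermx A).
  have cA : c *m A = 0 by apply/sub_kermxP; apply: row_sub.
  have : h (comb g c) (g j) = 0.
    by rewrite (bil_suml d) big1 // => l _; rewrite (bilZl d) gg mulr0.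
  have [u [Uu ->]] : exists u, U u /\ g j = ec (ab j).1 + fc (ab j).2 + u.
    by exists (g j - (ec (ab j).1 + fc (ab j).2)); rewrite [RHS]addrC subrK.
  rewrite (kerE c cA) !(bilDr d) (bil_comb_fU _ Uu) bil_comb_fe bil_comb_ff !addr0.
  rewrite /dot rmorph_sum => E; rewrite [LHS]mxE [RHS]mxE; apply: etrans E.
  apply: eq_bigr => l _; rewrite rmorphM /= (form_sK d) mulrC; congr (_ * _).
  by rewrite !mxE.
have inj : (kermx A :&: kermx B = 0)%MS.
  apply/eqP; rewrite -submx0; apply/row_subP => i.
  set c := row i _; have : (c <= kermx A :&: kermx B)%MS by apply: row_sub.
  rewrite sub_capmx => /andP[/sub_kermxP cA /sub_kermxP cB].
  by rewrite (gfree c) ?sub0mx // kerE // cB comb0.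
(* This bounds [\rank (kermx A *m B) + \rank A] by [n]; by [inj] the first rank is [k - \rank A]. *)
have r1 := mulmx0_rank_max orth.
have rk : \rank (kermx A *m B) = \rank (kermx A) by apply/mxrank_injP; rewrite inj eqxx.
rewrite mxrank_tr mxrank_map rk mxrank_ker in r1.
by apply: leq_trans _ r1; rewrite addnC -leq_subLR.
Qed.
End Witt.

(** * Subspaces containing a hyperbolic frame *)

Section SubspaceSpan.
Variables (K : fieldType) (V : lmodType K) (F : pform V) (d : form_data F).
Variables (n : nat) (e f : 'I_n -> V) (U : V -> Prop).
Hypothesis wd : witt_decomposition F e f U.
Hypothesis n_ge2 : (2 <= n)%N.
Variable X : V -> Prop.
Hypothesis subX : subspace F X.
Hypothesis Xe : forall i, X (e i).
Hypothesis Xf : forall i, X (f i).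
Notation s := (form_s d).
Notation Q := (form_Q d).
Notation T := (form_T d).
Notation h := (bil F).
Notation ec := (comb e).
Notation fc := (comb f).
Notation X0 := (with_zero X).
Notation dot := (dot d).
Implicit Types (a b : 'rV[K]_n) (u v x y : V).

Let rowD a b i : (a + b) 0 i = a 0 i + b 0 i. Proof. exact: mxE. Qed.
Let rowZ c a i : (c *: a) 0 i = c * a 0 i. Proof. exact: mxE. Qed.

Lemma with_zero_comb (g : 'I_n -> V) a : (forall i, X (g i)) ->
  (forall i j, h (g i) (g j) = 0) -> X0 (comb g a).
Proof.
move=> gX gg; rewrite /comb; elim: (index_enum _) => [|i r IH].
  by rewrite big_nil; left.
rewrite big_cons; apply: (with_zeroD subX) => //.
  by apply: (with_zeroZ subX); right.
rewrite (bil_sumr d) big1 // => j _.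
by rewrite (bilZr d) (bilZl d) gg !mulr0.
Qed.

Lemma with_zero_ec a : X0 (ec a).
Proof. by apply: with_zero_comb; rewrite // => i j; apply: (witt_ee d wd). Qed.

Lemma with_zero_fc a : X0 (fc a).
Proof. by apply: with_zero_comb; rewrite // => i j; apply: (witt_ff d wd). Qed.

Let in_X a b u := X0 (ec a + fc b + u).

(** The two vectors differ by an element of span e, and equality of the [dot] values says that this
    element is orthogonal to the first vector. *)
Lemma in_X_moveE a a' b u : U u -> dot a b = dot a' b -> in_X a b u -> in_X a' b u.
Proof.
move=> Uu ab aX; rewrite /in_X.
have -> : ec a' + fc b + u = (ec a + fc b + u) + ec (a' - a).
  by rewrite combB [RHS]addrC !addrA subrK.
apply: (with_zeroD subX) => //; first exact: with_zero_ec.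
rewrite combB (bilDr d) (bilNr d) !(bilDl d) !(bil_comb_ee d wd).
by rewrite !(bil_comb_fe d wd) !(bil_comb_Ue d wd) // ab subrr.
Qed.

Lemma in_X_moveF a b b' u : U u -> dot a b = dot a b' -> in_X a b u -> in_X a b' u.
Proof.
move=> Uu ab aX; rewrite /in_X.
have -> : ec a + fc b' + u = (ec a + fc b + u) + fc (b' - b).
  by rewrite combB [RHS]addrC !addrA (addrAC _ (ec a)) subrK (addrC (fc b')).
apply: (with_zeroD subX) => //; first exact: with_zero_fc.
rewrite combB (bilDr d) (bilNr d) !(bilDl d) !(bil_comb_ff d wd).
by rewrite !(bil_comb_ef d wd) !(bil_comb_Uf d wd) // ab subrr.
Qed.

Lemma singular_X0 v : X0 v -> singular F v.
Proof. exact: (with_zero_singular d). Qed.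

Section Coordinates.
Variables i0 i1 : 'I_n.
Hypothesis i10 : i1 != i0.
Let D i : 'rV[K]_n := delta_mx 0 i.

(** The two moves preserve [dot], and they connect all pairs with a given nonzero value of it, so
    one normal form represents them all. *)
Lemma in_X_canonical a b u : U u -> dot a b != 0 ->
  in_X a b u <-> in_X (D i0) (s (dot a b) *: D i0) u.
Proof.
move=> Uu.
have dotl i c b' : dot (c *: D i) b' = c * s (b' 0 i) := dot_deltal d b' i c.
have dotr a' i c : dot a' (c *: D i) = a' 0 i * s c := dot_deltar d a' i c.
have dot1 i b' : dot (D i) b' = s (b' 0 i) by rewrite -[D i]scale1r dotl mul1r.
have Dii i : D i 0 i = 1 by rewrite !mxE !eqxx.
have Dij i j : i != j -> D i 0 j = 0.
  by move=> ij; rewrite mxE eq_sym (negPf ij) andbF.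
have sK := form_sK d.
have iffE a1 a2 b1 : dot a1 b1 = dot a2 b1 -> in_X a1 b1 u <-> in_X a2 b1 u.
  by move=> E; split; apply: in_X_moveE.
have iffF a1 b1 b2 : dot a1 b1 = dot a1 b2 -> in_X a1 b1 u <-> in_X a1 b2 u.
  by move=> E; split; apply: in_X_moveF.
have case1 a1 b1 i : i != i0 -> b1 0 i != 0 ->
    in_X a1 b1 u <-> in_X (D i0) (s (dot a1 b1) *: D i0) u.
  move=> ii0 bi; set be := dot a1 b1.
  have sbi : s (b1 0 i) != 0 by rewrite fmorph_eq0.
  (* The coefficient at [i] adjusts the pairing with [b1] to [be], leaving the coordinate at [i0]
     equal to 1; then [b1] and finally [a2] can be replaced. *)
  pose a2 := D i0 + ((be - s (b1 0 i0)) / s (b1 0 i)) *: D i.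
  have a2b1 : dot a1 b1 = dot a2 b1.
    by rewrite dotDl dot1 dotl divfK // addrC subrK.
  have a2i0 : a2 0 i0 = 1 by rewrite rowD rowZ Dii Dij // mulr0 addr0.
  have a2c : dot a2 b1 = dot a2 (s be *: D i0).
    by rewrite -a2b1 dotr a2i0 mul1r sK.
  rewrite (iffE _ _ _ a2b1) (iffF _ _ _ a2c); apply: iffE.
  by rewrite !dotr a2i0 Dii.
move=> be0; case: (EM (exists i, i != i0 /\ b 0 i != 0)) => [[i []]|nex].
  exact: case1.
have bE : b = b 0 i0 *: D i0.
  apply/rowP => i; rewrite rowZ; have [->|ii0] := eqVneq i i0; first by rewrite Dii mulr1.
  rewrite Dij 1?eq_sym // mulr0; apply/eqP; apply: contrapT => /negP bi.
  by apply: nex; exists i.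
have a0 : a 0 i0 != 0.
  by apply: contra_neq be0 => a0; rewrite bE dotr a0 mul0r.
(* [b] is supported on [i0] only; adding a vector that pairs to 0 with [a] makes its [i1] coordinate
   1, which reduces to [case1]. *)
pose b' := b + (D i1 - s (a 0 i1 / a 0 i0) *: D i0).
have ab' : dot a b = dot a b'.
  have dotD1 : dot a (D i1) = a 0 i1 by rewrite -[D i1]scale1r dotr rmorph1 mulr1.
  rewrite dotDr dotDr -scaleNr dotr dotD1 rmorphN sK.
  by rewrite mulrN mulrCA divff // mulr1 subrr addr0.
rewrite (iffF _ _ _ ab') ab'; apply: (case1 _ _ i1 i10).
have D01 : D i0 0 i1 = 0 by apply: Dij; rewrite eq_sym.
rewrite /b' -scaleNr bE !rowD !rowZ Dii D01.
by rewrite !mulr0 add0r addr0 oner_neq0.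
Qed.

(* Adding z = ec (t D0 + D1) + fc (- g D0 + s(t) g D1) with t = g / dot a b to
   the canonical point changes the value of dot by g - s g. *)
Lemma in_X_change a b a' b' u : U u -> dot a b != 0 -> dot a' b' != 0 ->
  T (dot a b) = T (dot a' b') -> in_X a b u -> in_X a' b' u.
Proof.
move=> Uu be0 be0' TT /(in_X_canonical Uu be0) H.
apply/(in_X_canonical Uu be0'); move: H be0 be0' TT.
set be := dot a b; set be' := dot a' b' => H be0 be0' TT.
have [g gE] : exists g, be' - be = g - s g.
  by apply: (form_hilbert90 (f := d)); rewrite (form_TD d) (form_TN d) TT subrr.
have sK := form_sK d.
(* [t * be = g] makes the added vector orthogonal to the canonical point; the [D i1] terms make it
   singular. *)
pose t := g / be.
pose z1 := t *: D i0 + D i1; pose z2 := (- g) *: D i0 + (s t * g) *: D i1.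
have Dii i : D i 0 i = 1 by rewrite !mxE !eqxx.
have dotr c i k : dot c (k *: D i) = c 0 i * s k := dot_deltar d c i k.
have D01 : D i0 0 i1 = 0 by rewrite mxE (negPf i10) andbF.
have D10 : D i1 0 i0 = 0 by rewrite mxE eq_sym (negPf i10) andbF.
have z1z2 : dot z1 z2 = 0.
  rewrite /z2 dotDr !dotr /z1 !rowD !rowZ !Dii D01 D10.
  by rewrite rmorphN rmorphM sK; ring.
have X0z : X0 (ec z1 + fc z2).
  apply: (with_zeroD subX); [exact: with_zero_ec|exact: with_zero_fc|].
  by rewrite (bil_comb_ef d wd).
pose a1 := D i0 + z1; pose b1 := s be *: D i0 + z2.
have X1 : in_X a1 b1 u.
  rewrite /in_X.
  have -> : ec a1 + fc b1 + u = (ec (D i0) + fc (s be *: D i0) + u) + (ec z1 + fc z2).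
    rewrite [ec a1]combD [fc b1]combD. by rewrite (addrACA (ec _)) [LHS]addrAC.
  apply: (with_zeroD subX) => //.
  rewrite !(bilDl d) !(bilDr d) !(bil_comb_ee d wd) !(bil_comb_ff d wd).
  rewrite (bil_comb_ef d wd) (bil_comb_fe d wd) (bil_comb_Ue d wd) // (bil_comb_Uf d wd) //.
  rewrite /z2 dotDr !dotr /z1 !rowD !rowZ !Dii D01 D10 sK rmorphN.
  by rewrite /t; field; rewrite ?sK ?fmorph_eq0 ?be0.
have d1 : dot a1 b1 = be'.
  rewrite /b1 /z2 !dotDr !dotr /a1 /z1 !rowD !rowZ !Dii D01 D10 sK rmorphN rmorphM sK.
  by rewrite -(subrK be be') gE /t; field; rewrite ?sK ?fmorph_eq0 ?be0.
by move: X1; rewrite (in_X_canonical Uu) d1.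
Qed.

End Coordinates.

Let i0 : 'I_n := Ordinal (ltnW n_ge2).
Let i1 : 'I_n := Ordinal n_ge2.
Let i10 : i1 != i0. Proof. by []. Qed.
Let D i : 'rV[K]_n := delta_mx 0 i.
Let Dii i : D i 0 i = 1. Proof. by rewrite !mxE !eqxx. Qed.
Let D01 : D i0 0 i1 = 0. Proof. by rewrite mxE andbF. Qed.
Let D10 : D i1 0 i0 = 0. Proof. by rewrite mxE andbF. Qed.
Let dotr c i k : dot c (k *: D i) = c 0 i * s k := dot_deltar d c i k.

(** If [dot a b] is 0, the e-part and the f-part are collinear. Otherwise it has trace 0, so it is
    [g - s g], and some point of [X] with this pairing has to be exhibited before [in_X_change]
    applies. *)
Lemma in_X_hyperbolic a b : singular F (ec a + fc b) -> X0 (ec a + fc b).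
Proof.
have U0 : U 0 by case: (witt_lsub wd).
have dot0 a' b' : dot a' b' = 0 -> X0 (ec a' + fc b').
  move=> E; apply: (with_zeroD subX); [exact: with_zero_ec|exact: with_zero_fc|].
  by rewrite (bil_comb_ef d wd).
move=> sab; have tb : T (dot a b) = 0.
  move/(form_singular d): (sab).
  by rewrite -[X in form_Q _ X]addr0 (witt_Q d wd) // (form_Q0 d) addr0.
have [/dot0 //|be0] := eqVneq (dot a b) 0.
rewrite -[_ + fc b]addr0.
have [g gE] := form_hilbert90 tb.
(* The sum of two collinear points of pairing 0, one from [D i0] and [D i1], the other from
   [g *: D i1] and [- g *: D i0]; its own pairing is [g - s g]. *)
pose a' := D i0 + g *: D i1; pose b' := (- g) *: D i0 + D i1.
have dot1 c i : dot c (D i) = c 0 i by rewrite -[D i]scale1r dotr rmorph1 mulr1.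
have dab' : dot a' b' = dot a b.
  rewrite gE /a' /b' !dotDr dotr dot1 !rowD !rowZ !Dii D01 D10 rmorphN; ring.
apply: (in_X_change i10 U0 (a := a') (b := b')) => //; rewrite ?dab' //.
rewrite /in_X addr0.
have -> : ec a' + fc b' = (ec (D i0) + fc (D i1)) + (ec (g *: D i1) + fc (- g *: D i0)).
  by rewrite [ec a']combD [fc b']combD (addrC (fc (- g *: _))) addrACA.
apply: (with_zeroD subX).
- by apply: dot0; rewrite dot1.
- by apply: dot0; rewrite dotr rowZ D10 mulr0 mul0r.
rewrite !(bilDl d) !(bilDr d) !(bil_comb_ee d wd) !(bil_comb_ff d wd).
rewrite (bil_comb_ef d wd) (bil_comb_fe d wd) dotr dot1 rowZ !Dii rmorphN; ring.
Qed.

(** If [u] is nonzero, anisotropy gives [Q u != 0], so both pairings have the nonzero trace [- Q u]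
    and [in_X_change] applies. *)
Lemma in_X_same_anisotropic a b a' b' u : U u -> X0 (ec a + fc b + u) ->
  singular F (ec a' + fc b' + u) -> X0 (ec a' + fc b' + u).
Proof.
move=> Uu Xabu; have [->|u0] := eqVneq u 0.
  by rewrite addr0; apply: in_X_hyperbolic.
have Qu : Q u != 0 by apply/eqP => /(witt_anis wd Uu) E; rewrite E eqxx in u0.
have /(form_singular d) := singular_X0 Xabu.
rewrite (witt_Q d wd) // => E /(form_singular d); rewrite (witt_Q d wd) // => E'.
have dot0 (c c' : 'rV[K]_n) : T (dot c c') + Q u = 0 -> dot c c' != 0.
  by move=> H; apply: contra_neq Qu => c0; move: H; rewrite c0 (form_T0 d) add0r.
have TT : T (dot a b) = T (dot a' b') by apply: (addIr (Q u)); rewrite E E'.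
exact: (in_X_change i10 Uu (dot0 _ _ E) (dot0 _ _ E') TT Xabu).
Qed.

Let goodU u := U u /\
  forall a b, singular F (ec a + fc b + u) -> X0 (ec a + fc b + u).

Lemma goodU_of_X a b u : U u -> X0 (ec a + fc b + u) -> goodU u.
Proof. by move=> Uu Xp; split=> // a' b'; apply: in_X_same_anisotropic Xp. Qed.

Lemma goodU_lsubspace : lsubspace goodU.
Proof.
have [U0 UD UZ] := witt_lsub wd.
have dot1 c i : dot c (D i) = c 0 i by rewrite -[D i]scale1r dotr rmorph1 mulr1.
have dotl i b' : dot (D i) b' = s (b' 0 i).
  by rewrite -[D i]scale1r (dot_deltal d) mul1r.
have ex u : exists k, T k = - Q u.
  by have [k kE] := form_T_onto d u; exists (- k); rewrite (form_TN d) kE.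
split.
- by split=> // a b; rewrite addr0; apply: in_X_hyperbolic.
- move=> u1 u2 [Uu1 G1] [Uu2 G2].
  have [k1 k1E] := ex u1; have [k2 k2E] := ex u2.
  (* Points over [u1] and [u2] are placed in different hyperbolic planes; the last term of [b2]
     cancels [bil F u1 u2] and makes them collinear. *)
  pose b1 := s k1 *: D i0; pose b2 := s k2 *: D i1 + (- s (bil F u1 u2)) *: D i0.
  have X1 : X0 (ec (D i0) + fc b1 + u1).
    apply: G1; apply/(form_singular d).
    by rewrite (witt_Q d wd) // dotr Dii mul1r (form_sK d) k1E addNr.
  have X2 : X0 (ec (D i1) + fc b2 + u2).
    apply: G2; apply/(form_singular d).
    rewrite (witt_Q d wd) // dotl rowD !rowZ Dii D01 mulr0 addr0 mulr1.
    by rewrite (form_sK d) k2E addNr.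
  apply: (@goodU_of_X (D i0 + D i1) (b1 + b2)); first exact: UD.
  have -> : ec (D i0 + D i1) + fc (b1 + b2) + (u1 + u2) =
      (ec (D i0) + fc b1 + u1) + (ec (D i1) + fc b2 + u2).
    by rewrite combD (combD _ b1) (addrACA (ec _)) [LHS]addrACA.
  apply: (with_zeroD subX) => //.
  rewrite !(bilDl d) !(bilDr d) (bil_comb_ee d wd) (bil_comb_ff d wd).
  rewrite (bil_comb_ef d wd) (bil_comb_fe d wd).
  rewrite !(bil_comb_eU d wd, bil_comb_fU d wd, bil_comb_Ue d wd, bil_comb_Uf d wd) //.
  rewrite !dotl rowD !rowZ Dii D01 D10 !mulr0.
  by rewrite !rmorph0 !add0r !addr0 mulr1 rmorphN (form_sK d) addNr.
- move=> k u [Uu G]; have [k1 k1E] := ex u.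
  have Xp : X0 (ec (D i0) + fc (s k1 *: D i0) + u).
    apply: G; apply/(form_singular d).
    by rewrite (witt_Q d wd) // dotr Dii mul1r (form_sK d) k1E addNr.
  apply: (@goodU_of_X (k *: D i0) (k *: (s k1 *: D i0))); first exact: UZ.
  by rewrite !combZ -!scalerDr -combZ; apply: (with_zeroZ subX).
Qed.

Theorem subspace_eq_points_lspan : X = points F (lspan X).
Proof.
apply: subset_pts_anti.
  move=> v Xv; split; first exact: lspan_sub.
  by case: subX => -[+ _] _; apply.
have [G0 GD GZ] := goodU_lsubspace.
(* [W] is a linear subspace containing [X], and by the definition of [goodU] all its points lie in
   [X]. *)
pose W v := exists a b u, goodU u /\ v = ec a + fc b + u.
have lW : lsubspace W.
  split.
  - by exists 0, 0, 0; rewrite !comb0 !addr0.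
  - move=> _ _ [a [b [u [Gu ->]]]] [a' [b' [u' [Gu' ->]]]].
    exists (a + a'), (b + b'), (u + u'); split; first exact: GD.
    by rewrite !combD addrACA (addrACA (ec a)).
  - move=> c _ [a [b [u [Gu ->]]]]; exists (c *: a), (c *: b), (c *: u).
    by rewrite !combZ -!scalerDr; split=> //; apply: GZ.
have XW : subset_pts X W.
  move=> v Xv; have [a [b [u [Uu ev]]]] := witt_ex wd v.
  exists a, b, u; split=> //; apply: (@goodU_of_X a b) => //.
  by rewrite -ev; right.
move=> v [/(lspan_min lW XW)[a [b [u [[_ Gu] ev]]]] [v0 sv]].
by case: (Gu a b); rewrite -ev.
Qed.

End SubspaceSpan.

(** * Nice subspaces *)

Section NiceSubspaces.
Variables (K : fieldType) (V : lmodType K) (F : pform V) (d : form_data F).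
Notation s := (form_s d).
Notation Q := (form_Q d).
Notation T := (form_T d).
Notation h := (bil F).
Implicit Types (X Y M W U : V -> Prop) (u v x y : V).

Lemma comb_lsubspace n (g : 'I_n -> V) : lsubspace (fun x => exists a, x = comb g a).
Proof.
split; first by exists 0; rewrite comb0.
- by move=> _ _ [a ->] [b ->]; exists (a + b); rewrite combD.
- by move=> c _ [a ->]; exists (c *: a); rewrite combZ.
Qed.

Lemma lsubspace_comb n (g : 'I_n -> V) W a : lsubspace W -> (forall i, W (g i)) ->
  W (comb g a).
Proof.
move=> lW Wg; apply: lsubspace_sum => // i _.
by case: lW => _ _; apply.
Qed.

Lemma bil_comb_dual n (g g' : 'I_n -> V) (a : 'rV[K]_n) i :
  (forall i j, h (g i) (g' j) = (i == j)%:R) -> h (comb g a) (g' i) = a 0 i.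
Proof.
move=> gg'; rewrite (bil_suml d) (bigD1 i) //= (bilZl d) gg' eqxx mulr1.
rewrite big1 ?addr0 // => j ji; by rewrite (bilZl d) gg' (negPf ji) mulr0.
Qed.

(** The anisotropic part is the common orthogonal complement of the two families. *)
Lemma dual_witt_decomposition n (g g' : 'I_n -> V) :
  (forall i, singular F (g i)) -> (forall i, singular F (g' i)) ->
  (forall i j, h (g i) (g j) = 0) -> (forall i j, h (g' i) (g' j) = 0) ->
  (forall i j, h (g i) (g' j) = (i == j)%:R) ->
  (forall x, (forall i, h x (g i) = 0) -> (forall i, h x (g' i) = 0) ->
     singular F x -> x = 0) ->
  exists U, witt_decomposition F g g' U.
Proof.
move=> sg sg' gg g'g' gg' anis.
have g'g i j : h (g' i) (g j) = (i == j)%:R.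
  by rewrite (bilC d) gg' rmorph_nat eq_sym.
have bilsum a b x i : (forall i, h x (g i) = 0) -> (forall i, h x (g' i) = 0) ->
    h (comb g a + comb g' b + x) (g' i) = a 0 i /\
    h (comb g a + comb g' b + x) (g i) = b 0 i.
  move=> xg xg'; rewrite !(bilDl d) xg xg' (bil_comb_dual _ _ gg') (bil_comb_dual _ _ g'g).
  rewrite !(bil_suml d) !big1 ?add0r ?addr0 // => j _.
    by rewrite (bilZl d) gg mulr0.
  by rewrite (bilZl d) g'g' mulr0.
have combE (a b : 'I_n -> K) : \sum_(i < n) (a i *: g i + b i *: g' i) =
    comb g (\row_i a i) + comb g' (\row_i b i).
  by rewrite -big_split; apply: eq_bigr => i _; rewrite !mxE.
exists (fun x => (forall i, h x (g i) = 0) /\ (forall i, h x (g' i) = 0)); split.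
- by move=> i; rewrite gg' eqxx.
- by move=> i j ij; rewrite gg gg' g'g g'g' (negPf ij).
- have [p0 pD pZ] := perp_lsubspace d g; have [q0 qD qZ] := perp_lsubspace d g'.
  split=> [//|x y [xg xg'] [yg yg']|a x [xg xg']]; split.
  + exact: pD.
  + exact: qD.
  + exact: pZ.
  + exact: qZ.
split.
- move=> i x [xg xg']; split=> //; exact: (bil_orthC d).
- by move=> x [xg xg']; apply: anis.
- move=> v; pose a i := h v (g' i); pose b i := h v (g i).
  exists a, b, (v - \sum_(i < n) (a i *: g i + b i *: g' i)); split; last first.
    by rewrite addrC subrK.
  have E i : h (comb g (\row_i a i) + comb g' (\row_i b i)) (g' i) = a i /\
      h (comb g (\row_i a i) + comb g' (\row_i b i)) (g i) = b i.
    have [||E1 E2] := bilsum (\row_i a i) (\row_i b i) 0 i; try by move=> j; rewrite (bil0l d).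
    by move: E1 E2; rewrite addr0 !mxE.
  by rewrite combE; split=> i; rewrite (bilDl d) (bilNl d) ?(proj1 (E i)) ?(proj2 (E i)) subrr.
- move=> a b x [xg xg']; rewrite combE => E.
  have {}ab i : a i = 0 /\ b i = 0.
    have [E1 E2] := bilsum (\row_i a i) (\row_i b i) x i xg xg'.
    by move: E1 E2; rewrite E !(bil0l d) !mxE.
  split=> //; move: E; rewrite /comb !big1 ?add0r // => i _; rewrite mxE;
    by case: (ab i) => ai bi; rewrite ?ai ?bi scale0r.
Qed.

Lemma witt_free n (e f : 'I_n -> V) U (c : 'rV[K]_n) :
  witt_decomposition F e f U -> comb e c = 0 -> c = 0.
Proof.
move=> wd c0; have U0 : U 0 by case: (witt_lsub wd).
by case: (witt_uniq d wd (a := c) (b := 0) U0); rewrite // comb0 c0 !addr0.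
Qed.

Lemma witt_decompositionC n (e f : 'I_n -> V) U :
  witt_decomposition F e f U -> witt_decomposition F f e U.
Proof.
move=> wd; have [w1 w2 w3 [w4 w5 w6 w7]] := wd; split=> //.
- by move=> i; have [se sf _] := w1 i; rewrite (witt_fe d wd) eqxx.
- by move=> i j ij; case: (w2 i j ij).
split=> //.
- by move=> i x /(w4 i)[].
- move=> v; have [a [b [x [Ux ->]]]] := w6 v; exists b, a, x; split=> //.
  by congr (_ + _); apply: eq_bigr => i _; rewrite addrC.
- move=> a b x Ux; under eq_bigr do rewrite addrC.
  by move/(w7 _ _ _ Ux) => [ab ->]; split=> // i; case: (ab i).
Qed.

Section Frames.
Variables (n : nat) (e0 f0 : 'I_n -> V) (U0 : V -> Prop).
Hypothesis wd0 : witt_decomposition F e0 f0 U0.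
Hypothesis n_ge2 : (2 <= n)%N.

Lemma witt_index_unique k (e f : 'I_k -> V) U : witt_decomposition F e f U -> k = n.
Proof.
move=> wd; apply/eqP; rewrite eqn_leq; apply/andP; split.
  apply: (totally_singular_dim d wd0 (g := e)); last by move=> c; apply: witt_free wd.
    by case: wd => + _ _ _ => w i; case: (w i).
  exact: (witt_ee d wd).
apply: (totally_singular_dim d wd (g := e0)); last by move=> c; apply: witt_free wd0.
  by case: wd0 => + _ _ _ => w i; case: (w i).
exact: (witt_ee d wd0).
Qed.

(** A longest pair of dual families in [M1] and [M2] exists, since [totally_singular_dim] bounds the
    length by [n]. Being longest, it leaves an anisotropic complement and so is a frame; its length
    is [n] by [witt_index_unique]. *)
Lemma disjoint_max_sing_frame M1 M2 :
  max_sing_subspace F M1 -> max_sing_subspace F M2 -> disjoint_pts M1 M2 ->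
  exists (e f : 'I_n -> V) U, [/\ witt_decomposition F e f U,
    forall i, M1 (e i) & forall i, M2 (f i)].
Proof.
move=> max1 max2 dis; have [[sub1 ts1] _] := max1; have [[sub2 ts2] _] := max2.
have [l20 l2D l2Z] := sing_subspace_lsubspace d (proj1 max2).
have l1 := sing_subspace_lsubspace d (proj1 max1).
have l2 := sing_subspace_lsubspace d (proj1 max2).
pose dual k (g g' : nat -> V) :=
  (forall i, (i < k)%N -> M1 (g i) /\ M2 (g' i)) /\
  (forall i j, (i < k)%N -> (j < k)%N -> h (g i) (g' j) = (i == j)%:R).
have bound k g g' : dual k g g' -> (k <= n)%N.
  move=> [Mg gg']; have gg'o (i j : 'I_k) : h (g i) (g' j) = (i == j)%:R by apply: gg'.
  apply: (totally_singular_dim d wd0 (g := fun i : 'I_k => g i)).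
  - by move=> i; case: (ts1 (g i) (g i)); case: (Mg i _).
  - by move=> i j; case: (ts1 (g i) (g j)); [case: (Mg i _)|case: (Mg j _)|].
  - move=> c c0; apply/rowP => i.
    by rewrite -(bil_comb_dual c i gg'o) c0 (bil0l d) mxE.
have extend k g g' x : dual k g g' -> M1 x -> (forall i, (i < k)%N -> h x (g' i) = 0) ->
    exists g1 g1', dual k.+1 g1 g1'.
  move=> [Mg gg'] M1x xg'.
  (* If [x] were orthogonal to [M2], it would lie in [M2] by maximality, against disjointness. *)
  have [y [M2y xy]] : exists y, M2 y /\ h x y <> 0.
    apply: contrapT => nex; have [x0 sx] := (proj1 (proj1 sub1)) x M1x.
    case: (max_sing_subspace_perp d max2 sx) => // [m M2m|]; last exact: dis.
    apply: (bil_orthC d); apply: contrapT => xm; apply: nex; by exists m.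
  (* Gram-Schmidt: [y] is made orthogonal to the earlier [g i]. Its pairing with [x] is unchanged
     because [x] is orthogonal to the [g' i]. *)
  pose y1 := y - \sum_(i < k) s (h (g i) y) *: g' i.
  have xy1 : h x y1 = h x y.
    rewrite /y1 (bilDr d) (bilNr d) (bil_sumr d) big1 ?subr0 // => i _.
    by rewrite (bilZr d) xg' ?mulr0.
  have gy1 j : (j < k)%N -> h (g j) y1 = 0.
    move=> jk; rewrite /y1 (bilDr d) (bilNr d) (bil_sumr d) (bigD1 (Ordinal jk)) //=.
    rewrite (bilZr d) gg' // eqxx mulr1 (form_sK d) big1 ?addr0 ?subrr // => i ij.
    rewrite (bilZr d) gg' // (_ : (j == i) = false) ?mulr0 //.
    by apply: contraNF ij => /eqP ji; apply/eqP/val_inj.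
  have M2y1 : with_zero M2 y1.
    apply: (lsubspaceB l2); first by right.
    apply: (lsubspace_sum _ l2) => i _; apply: l2Z; right; by case: (Mg i _).
  pose y2 := s (h x y)^-1 *: y1.
  have xy2 : h x y2 = 1 by rewrite (bilZr d) (form_sK d) xy1 mulVf //; apply/eqP.
  have M2y2 : M2 y2.
    case: (l2Z (s (h x y)^-1) _ M2y1) => // E; move: xy2.
    by rewrite /y2 E (bil0r d) => /esym/eqP; rewrite oner_eq0.
  have gy2 j : (j < k)%N -> h (g j) y2 = 0.
    by move=> jk; rewrite /y2 (bilZr d) gy1 // mulr0.
  clearbody y2.
  exists (fun i => if i == k then x else g i), (fun i => if i == k then y2 else g' i).
  split=> [i|i j].
    rewrite ltnS leq_eqVlt => /predU1P[->|ik]; first by rewrite eqxx.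
    by rewrite ltn_eqF //; apply: Mg.
  rewrite ltnS leq_eqVlt => /predU1P[->|ik].
    rewrite eqxx ltnS leq_eqVlt => /predU1P[->|jk]; first by rewrite eqxx.
    by rewrite [j == k]ltn_eqF // xg' // eq_sym ltn_eqF.
  rewrite [i == k]ltn_eqF // ltnS leq_eqVlt => /predU1P[->|jk].
    by rewrite eqxx gy2 // ltn_eqF.
  by rewrite [j == k]ltn_eqF // gg'.
have [k [g [g' [dg nodg]]]] : exists k g g', dual k g g' /\
    ~ exists g1 g1', dual k.+1 g1 g1'.
  apply: contrapT => nex.
  have all k : exists g g', dual k g g'.
    elim: k => [|k [g [g' dg]]]; first by exists (fun=> 0), (fun=> 0); split.
    by apply: contrapT => n1; apply: nex; exists k, g, g'.
  by have [g [g' /bound]] := all n.+1; rewrite ltnn.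
have [Mg gg'] := dg.
have zero1 x : with_zero M1 x -> (forall i, (i < k)%N -> h x (g' i) = 0) -> x = 0.
  by move=> [//|M1x] xg'; case: nodg; apply: extend dg M1x xg'.
pose e (i : 'I_k) := g i; pose f (i : 'I_k) := g' i.
have ef i j : h (e i) (f j) = (i == j)%:R by apply: gg'.
have M1e i : M1 (e i) by case: (Mg i _).
have M2f i : M2 (f i) by case: (Mg i _).
have [U wd] : exists U, witt_decomposition F e f U.
  apply: dual_witt_decomposition (ef) _.
  - by move=> i; case: (ts1 _ _ (M1e i) (M1e i)).
  - by move=> i; case: (ts2 _ _ (M2f i) (M2f i)).
  - by move=> i j; case: (ts1 _ _ (M1e i) (M1e j)).
  - by move=> i j; case: (ts2 _ _ (M2f i) (M2f j)).
  move=> z ze zf sz; apply: (zero1) => [|i ik]; last exact: (zf (Ordinal ik)).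
  apply: (max_sing_subspace_perp d max1 sz) => m M1m.
  (* [m - comb e c] lies in [M1] and is orthogonal to every [f i], so it is 0. Thus [e] spans [M1],
     and [z] is orthogonal to [M1]. *)
  pose c : 'rV[K]_k := \row_i h m (f i).
  have : m - comb e c = 0.
    apply: (zero1) => [|i ik].
      apply: (lsubspaceB l1); first by right.
      by apply: lsubspace_comb => // i; right.
    rewrite (bilDl d) (bilNl d).
    by rewrite -[g' i]/(f (Ordinal ik)) (bil_comb_dual _ _ ef) mxE subrr.
  move/subr0_eq ->; rewrite (bil_suml d) big1 // => i _.
  by rewrite (bilZl d) (bil_orthC d (ze i)) mulr0.
have ek := witt_index_unique wd; subst k.
by exists e, f, U.
Qed.

(** Orthogonality to every [e i] kills the f-coordinates of a point of a larger singular subspace;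
    its [U]-component is then singular, hence 0. *)
Lemma max_sing_comb (e f : 'I_n -> V) U : witt_decomposition F e f U ->
  max_sing_subspace F (points F (fun x => exists a, x = comb e a)).
Proof.
move=> wd; have le := comb_lsubspace e; split.
  apply: (points_sing_subspace d le) => [_ [a ->]|_ _ [a ->] [b ->]].
    exact: (singular_ec d wd).
  exact: (bil_comb_ee d wd).
move=> Y [sY tY] eY y Yy; have ptY := proj1 (proj1 sY).
split; last exact: ptY.
have [a [b [u [Uu ey]]]] := witt_ex wd y.
have b0 : b = 0.
  apply/rowP => i; rewrite -(witt_coordF d wd a b i Uu) -ey mxE.
  have Ye : Y (e i).
    apply: eY; split; first by exists (delta_mx 0 i); rewrite comb_delta.
    split; last by case: wd => + _ _ _ => w; case: (w i).
    move=> e00; move: (witt_ef wd i i); rewrite e00 (bil0l d) eqxx => /esym/eqP.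
    by rewrite oner_eq0.
  by case: (tY y (e i) Yy Ye).
have sy : singular F y by case: (ptY _ Yy).
move: sy ey; rewrite b0 comb0 addr0 => sy ey; exists a; rewrite ey (_ : u = 0) ?addr0 //.
apply: (witt_anis (d := d) wd Uu); apply/(form_singular d).
apply: (singular_orthD d (singular_ec d wd a)); first exact: (bil_comb_eU d wd).
by rewrite -ey.
Qed.

Definition contains_frame W : Prop := lsubspace W /\
  exists (e f : 'I_n -> V) U, witt_decomposition F e f U /\
    (forall i, W (e i)) /\ (forall i, W (f i)).

Lemma nice_contains_frame X : nice F X ->
  contains_frame (lspan X) /\ X = points F (lspan X).
Proof.
move=> [subX [M1 [M2 [max1 max2 dis M1X M2X]]]].
have [e [f [U [wd M1e M2f]]]] := disjoint_max_sing_frame max1 max2 dis.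
have Xe i : X (e i) by apply: M1X.
have Xf i : X (f i) by apply: M2X.
split; last exact: (subspace_eq_points_lspan d wd).
split; first exact: lspan_lsubspace.
by exists e, f, U; split=> //; split=> i; apply: lspan_sub.
Qed.

Lemma contains_frame_nice W : contains_frame W -> nice F (points F W).
Proof.
move=> [lW [e [f [U [wd [We Wf]]]]]]; split; first exact: (points_subspace d).
exists (points F (fun x => exists a, x = comb e a)),
  (points F (fun x => exists a, x = comb f a)); split.
- exact: max_sing_comb wd.
- exact: max_sing_comb (witt_decompositionC wd).
- move=> v [[a ->] [v0 _]] [[b E] _]; apply: v0.
  have U00 : U 0 by case: (witt_lsub wd).
  have [|-> _ _] := witt_uniq d wd (a := a) (b := - b) U00.
    by rewrite -[- b]add0r combB comb0 add0r addr0 -E subrr.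
  exact: comb0.
- by move=> v [[a ->] pv]; split=> //; apply: lsubspace_comb.
- by move=> v [[a ->] pv]; split=> //; apply: lsubspace_comb.
Qed.

(** Singular vectors span [W] although [U] is anisotropic: a component [u] is the difference of two
    singular vectors, the smaller one chosen as in the case of a pairing of trace [- Q u]. *)
Lemma contains_frame_lspan_points W : contains_frame W -> lspan (points F W) = W.
Proof.
move=> [lW [e [f [U [wd [We Wf]]]]]]; apply: subset_pts_anti.
  by apply: lspan_min => // v [].
have sing v : W v -> singular F v -> lspan (points F W) v.
  move=> Wv sv; have [->|v0] := eqVneq v 0; first by case: (lspan_lsubspace (points F W)).
  by apply: lspan_sub; split=> //; split=> //; apply/eqP.
have [_ LD LZ] := lspan_lsubspace (points F W).
have lE a : lspan (points F W) (comb e a).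
  by apply: sing; [apply: lsubspace_comb|apply: (singular_ec d wd)].
have lF a : lspan (points F W) (comb f a).
  by apply: sing; [apply: lsubspace_comb|apply: (singular_fc d wd)].
move=> w Ww; have [a [b [u [Uu ew]]]] := witt_ex wd w.
rewrite ew; apply: (LD); first exact: LD.
pose i0 : 'I_n := Ordinal (ltnW n_ge2); pose D : 'rV[K]_n := delta_mx 0 i0.
have [k kE] := form_T_onto d u.
have Wab c c' : W (comb e c + comb f c').
  by case: (lW) => _ WD _; apply: WD; apply: lsubspace_comb.
have Wu : W u.
  have -> : u = w - (comb e a + comb f b) by rewrite ew addrC addKr.
  exact: lsubspaceB.
have -> : u = (comb e D + comb f (s (- k) *: D) + u) - (comb e D + comb f (s (- k) *: D)).
  by rewrite addrC addKr.
apply: (lsubspaceB (lspan_lsubspace _)); last exact: LD.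
apply: sing; first by case: (lW) => _ WD _; apply: WD.
apply/(form_singular d); rewrite (witt_Q d wd) // (dot_deltar d) (form_sK d).
by rewrite mxE !eqxx mul1r (form_TN d) kE addNr.
Qed.

Lemma contains_frame_up W W' : contains_frame W -> lsubspace W' ->
  subset_pts W W' -> contains_frame W'.
Proof.
move=> [_ [e [f [U [wd [We Wf]]]]]] lW' WW'; split=> //.
by exists e, f, U; split=> //; split=> i; apply: WW'.
Qed.

Lemma contains_frame_total : contains_frame (fun=> True).
Proof. by split; [split|exists e0, f0, U0]. Qed.

(** The square matrix expressing [g'] in terms of [g] has zero kernel, so it is invertible. *)
Lemma free_family_spans m (g g' : 'I_m -> V) :
  (forall i, exists a, g' i = comb g a) -> (forall c, comb g' c = 0 -> c = 0) ->
  forall i, exists a, g i = comb g' a.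
Proof.
move=> /choice[A AP] free.
have combE c : comb g' c = comb g (c *m \matrix_i A i).
  rewrite mulmx_sum_row (big_morph (comb g) (id1 := 0) (op1 := +%R)); first last.
  - exact: comb0.
  - exact: combD.
  by apply: eq_bigr => i _; rewrite rowK combZ AP.
have unitA : \matrix_i A i \in unitmx.
  rewrite -row_free_unit -kermx_eq0 -submx0; apply/row_subP => i.
  set c := row i _; have cA : c *m \matrix_i A i = 0 by apply/sub_kermxP; apply: row_sub.
  by rewrite (free c) ?sub0mx // combE cA comb0.
move=> i; exists (delta_mx 0 i *m invmx (\matrix_i A i)).
by rewrite combE mulmxKV // comb_delta.
Qed.

(** Two frames have the same number 2n of vectors, both families are free, and [free_family_spans]
    turns an inclusion of their spans into an equality. *)
Lemma contains_frame_min W : contains_frame W -> exists r : seq V,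
  [/\ contains_frame (lspan [in r]), subset_pts (lspan [in r]) W
    & forall W', contains_frame W' -> subset_pts W' (lspan [in r]) ->
        subset_pts (lspan [in r]) W'].
Proof.
pose join (e f : 'I_n -> V) (i : 'I_(n + n)) :=
  match split i with inl j => e j | inr j => f j end.
have joinP (P : V -> Prop) e f : (forall i, P (join e f i)) <->
    (forall i, P (e i)) /\ (forall i, P (f i)).
  split=> [Pj|[Pe Pf] i]; last by rewrite /join; case: (split i).
  split=> i; first by have := Pj (lshift n i); rewrite /join (unsplitK (inl i)).
  by have := Pj (rshift n i); rewrite /join (unsplitK (inr i)).
have join_free e f U c : witt_decomposition F e f U -> comb (join e f) c = 0 -> c = 0.
  move=> wd; have U00 : U 0 by case: (witt_lsub wd).
  have -> : comb (join e f) c = comb e (lsubmx c) + comb f (rsubmx c) + 0.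
    rewrite addr0 /comb big_split_ord; congr (_ + _); apply: eq_bigr => i _.
      by rewrite mxE /join (unsplitK (inl i)).
    by rewrite mxE /join (unsplitK (inr i)).
  move/(witt_uniq d wd U00) => [l0 r0 _].
  by rewrite -[c]hsubmxK l0 r0 row_mx0.
move=> [lW [e [f [U [wd [We Wf]]]]]]; exists (codom (join e f)).
have lspanE v : lspan [in codom (join e f)] v -> exists a, v = comb (join e f) a.
  apply: (lspan_min (comb_lsubspace (join e f))) => x /codomP[i ->].
  by exists (delta_mx 0 i); rewrite comb_delta.
have lj i : lspan [in codom (join e f)] (join e f i).
  by apply: lspan_sub; apply: codom_f.
split.
- split; first exact: lspan_lsubspace.
  by exists e, f, U; split=> //; exact: (proj1 (joinP _ e f) lj).
- have Wj := proj2 (joinP _ e f) (conj We Wf).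
  by apply: lspan_min => // x /codomP[i ->].
move=> W' [lW' [e' [f' [U' [wd' [We' Wf']]]]]] W'r.
have Wj' := proj2 (joinP _ e' f') (conj We' Wf').
have /free_family_spans ex : forall i, exists a, join e' f' i = comb (join e f) a.
  by move=> i; apply: lspanE; apply: W'r.
apply: lspan_min => // x /codomP[i ->].
have [|a ->] := ex _ i; first by move=> c; apply: join_free wd'.
exact: lsubspace_comb.
Qed.

End Frames.
End NiceSubspaces.

(** * The theorem *)

Section Transfer.
Variables (K : fieldType) (V : lmodType K) (N N' : (V -> Prop) -> Prop).
Variable phi : (V -> Prop) -> V -> Prop.
Hypothesis phiN : forall X, N X -> N' (phi X).
Hypothesis phi_mono : forall X Y, subset_pts X Y -> subset_pts (phi X) (phi Y).

Definition image_chain (g : (V -> Prop) -> V -> Prop) (C : (V -> Prop) -> Prop) :=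
  fun Y => exists X, C X /\ Y = g X.

Lemma wo_chain_image C : wo_chain_in N C -> wo_chain_in N' (image_chain phi C).
Proof.
move=> [[CN Cch] Cwo]; split; first split.
- by move=> _ [X [CX ->]]; apply: phiN; apply: CN.
- move=> _ _ [X [CX ->]] [Y [CY ->]].
  by case: (Cch X Y CX CY) => /phi_mono; [left|right].
move=> D DC [Y DY]; have [X [CX eY]] := DC Y DY.
have [||X1 [[CX1 DX1] X1min]] := Cwo (fun X => C X /\ D (phi X)); first by move=> ? [].
  by exists X; rewrite -eY.
exists (phi X1); split=> // Z DZ; have [X2 [CX2 eZ]] := DC Z DZ.
by rewrite eZ; apply: phi_mono; apply: X1min; rewrite -eZ.
Qed.

End Transfer.

(** Maximality passes along an order isomorphism. It is used with [lspan] to reach linear subspaces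
    and with [points] to return. *)
Lemma max_wo_chain_image (K : fieldType) (V : lmodType K)
    (N N' : (V -> Prop) -> Prop) (phi psi : (V -> Prop) -> V -> Prop) C :
  (forall X, N X -> N' (phi X)) -> (forall Y, N' Y -> N (psi Y)) ->
  (forall X Y, subset_pts X Y -> subset_pts (phi X) (phi Y)) ->
  (forall X Y, subset_pts X Y -> subset_pts (psi X) (psi Y)) ->
  (forall X, N X -> psi (phi X) = X) -> (forall Y, N' Y -> phi (psi Y) = Y) ->
  max_wo_chain_in N C -> max_wo_chain_in N' (image_chain phi C).
Proof.
move=> phiN psiN phi_mono psi_mono phiK psiK [Cwo Cmax].
split; first exact: (wo_chain_image phiN).
move=> C' C'wo CC' Y C'Y.
have C'N Z : C' Z -> N' Z by case: C'wo => -[+ _] _; apply.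
exists (psi Y); split; last by rewrite psiK //; apply: C'N.
apply: (Cmax (image_chain psi C')); first exact: (wo_chain_image psiN).
- move=> X CX; exists (phi X); split; first by apply: CC'; exists X.
  by rewrite phiK //; case: Cwo => -[+ _] _; apply.
- by exists Y.
Qed.

(** * A basis of the whole space from one of the anisotropic part *)

Section HamelBasis.
Variables (K : fieldType) (V : lmodType K) (F : pform V) (d : form_data F).
Variables (n : nat) (e f : 'I_n -> V) (V0 B : V -> Prop).
Hypothesis wd : witt_decomposition F e f V0.
Hypothesis hB : hamel_basis_of V0 B.

Lemma hamel_not_lspan b : B b -> ~ lspan (fun x => B x /\ x <> b) b.
Proof.
have [_ free _] := hB => Bb /lspan_comb[s [c [us sB bE]]].
have bs : b \notin s by apply/negP => /sB[].
(* A combination equal to [b] becomes a vanishing one with coefficient -1 at [b]. *)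
have := free (b :: s) (fun v => if v == b then -1 else c v); rewrite /= bs us.
move=> /(_ isT) H; have {H} : (if b == b then -1 else c b) = 0; last first.
  by rewrite eqxx => /eqP; rewrite oppr_eq0 oner_eq0.
apply: H; last by rewrite inE eqxx.
  by move=> v; rewrite inE => /predU1P[->//|/sB[]].
rewrite big_cons eqxx scaleN1r {1}bE addrC; apply/eqP; rewrite subr_eq0; apply/eqP.
apply: eq_big_seq => v vs; case: eqP => // vb; by rewrite -vb vs in bs.
Qed.

Definition witt_basis : V -> Prop := fun b => B b \/ b \in codom e ++ codom f.

Lemma witt_basisE (P : V -> Prop) : (forall x, B x -> P x) ->
  (forall i, P (e i)) -> (forall i, P (f i)) -> forall x, witt_basis x -> P x.
Proof.
move=> PB Pe Pf x [/PB//|]; rewrite mem_cat.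
by case/orP => /codomP[i ->].
Qed.

Lemma witt_basis_total v : lspan witt_basis v.
Proof.
have [a [b [x [V0x ->]]]] := witt_ex wd v.
have [_ LD LZ] := lspan_lsubspace witt_basis; have lL := lspan_lsubspace witt_basis.
have [_ _ span] := hB; have [s [c [sB ->]]] := span x V0x.
apply: (LD).
  by apply: (LD); apply: lsubspace_comb => // i; apply: lspan_sub; right;
    rewrite mem_cat codom_f ?orbT.
rewrite big_seq; apply: (lsubspace_sum _ lL) => u us; apply: (LZ).
by apply: lspan_sub; left; apply: sB.
Qed.

(** A frame vector is separated from the other basis vectors by pairing with its dual; for [b] in
    [B] the frame coordinates drop out by uniqueness, leaving the independence of [B]. *)
Lemma witt_basis_free b : witt_basis b -> ~ lspan (fun x => witt_basis x /\ x <> b) b.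
Proof.
have [BV0 _ _] := hB; have lV0 := witt_lsub wd.
have [V00 V0D _] := lV0.
have perp_free (c c' : V) : bil F c c' = 1 ->
    (forall x, witt_basis x -> x <> c -> bil F x c' = 0) ->
    ~ lspan (fun x => witt_basis x /\ x <> c) c.
  move=> cc' ortho /(lspan_min (perp_lsubspace d (fun _ : unit => c'))) H.
  have /H/(_ tt)/eqP : subset_pts (fun x => witt_basis x /\ x <> c)
      (fun x => unit -> bil F x c' = 0) by move=> x [? ?] _; apply: ortho.
  by rewrite cc' oner_eq0.
apply: (@witt_basisE (fun b => ~ lspan (fun x => witt_basis x /\ x <> b) b))
  => {b} [b Bb|i|i].
- move=> lb; apply: (hamel_not_lspan Bb).
  set S := fun x => B x /\ x <> b.
  have lS := lspan_lsubspace S; have [S0 SD SZ] := lS.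
  have SV0 x : lspan S x -> V0 x by apply: lspan_min => // y [/BV0].
  have [a [c [x [Sx bE]]]] : exists a c x, lspan S x /\ b = comb e a + comb f c + x.
    apply: (lspan_min (W := fun v => exists a c x, lspan S x /\ v = comb e a + comb f c + x)) lb.
      split.
      + by exists 0, 0, 0; rewrite !comb0 !addr0.
      + move=> _ _ [a [c [x [Sx ->]]]] [a' [c' [x' [Sx' ->]]]].
        exists (a + a'), (c + c'), (x + x'); split; first exact: SD.
        by rewrite !combD addrACA (addrACA (comb e a)).
      + move=> k _ [a [c [x [Sx ->]]]]; exists (k *: a), (k *: c), (k *: x).
        by rewrite !combZ -!scalerDr; split=> //; apply: SZ.
    move=> x [wx xb]; move: x wx xb.
    apply: (@witt_basisE (fun x => x <> b -> exists a c y,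
      lspan S y /\ x = comb e a + comb f c + y)) => [x Bx|i|i] xb.
    + by exists 0, 0, x; rewrite !comb0 !add0r; split=> //; apply: lspan_sub.
    + by exists (delta_mx 0 i), 0, 0; rewrite comb_delta comb0 !addr0.
    + by exists 0, (delta_mx 0 i), 0; rewrite comb_delta comb0 add0r addr0.
  have V0xb : V0 (x - b) by apply: lsubspaceB => //; [apply: SV0|apply: BV0].
  have [|_ _ /subr0_eq <-//] := witt_uniq d wd (a := a) (b := c) V0xb.
  by rewrite addrA -bE subrr.
- apply: (perp_free _ (f i)); first by rewrite (witt_ef wd) eqxx.
  apply: (@witt_basisE (fun x => x <> e i -> bil F x (f i) = 0))
    => [x /BV0 V0x _|j ji|j _]; last exact: (witt_ff d wd).
    exact: (bil_orthC d (witt_fU wd i V0x)).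
  rewrite (witt_ef wd); case: eqP => // ij; by case: ji; rewrite ij.
- apply: (perp_free _ (e i)); first by rewrite (witt_fe d wd) eqxx.
  apply: (@witt_basisE (fun x => x <> f i -> bil F x (e i) = 0))
    => [x /BV0 V0x _|j _|j ji]; first 2 last.
  + rewrite (witt_fe d wd); case: eqP => // ij; by case: ji; rewrite ij.
  + exact: (bil_orthC d (witt_eU wd i V0x)).
  + exact: (witt_ee d wd).
Qed.

End HamelBasis.

Theorem theorem4 (K : fieldType) (V : lmodType K) (F : pform V) (n : nat)
    (e f : 'I_n -> V) (V0 : V -> Prop) (B : V -> Prop) :
  nondeg_form F ->
  (2 <= n)%N ->
  witt_decomposition F e f V0 ->
  hamel_basis_of V0 B ->
  infinite_set B ->
  (forall C, max_wo_chain F C -> equipotent C B) /\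
  (forall C, wo_chain F C ->
     exists C', max_wo_chain F C' /\ (forall X, C X -> C' X)).
Proof.
move=> /nondeg_form_data[d] n2 wd hB infB.
pose good := @contains_frame K V F n.
have niceL X : nice F X -> good (lspan X) by case/(nice_contains_frame d wd n2).
have goodP W : good W -> nice F (points F W) := @contains_frame_nice _ _ _ d _ W.
have pointsM X Y : subset_pts X Y -> subset_pts (points F X) (points F Y).
  by move=> XY v [/XY].
have spanM := @lspanS K V.
have nK X : nice F X -> points F (lspan X) = X.
  by case/(nice_contains_frame d wd n2).
have gK W : good W -> lspan (points F W) = W.
  exact: (contains_frame_lspan_points d n2).
have glsub W : good W -> lsubspace W by case.
have gup := @contains_frame_up K V F n.
have gtot : good (fun=> True) := contains_frame_total wd.
have gmin := @contains_frame_min K V F d n.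
split=> C Cmax.
- have Cch : wo_chain_in (nice F) C by case: Cmax.
  have CL := max_wo_chain_image niceL goodP spanM pointsM nK gK Cmax.
  have Binf' : dedekind_infinite B by apply: dedekind_infiniteP.
  (* The basis of [V] adds only the frame vectors to the infinite set [B]. *)
  apply: equipotent_trans (equipotent_add_seq (codom e ++ codom f) Binf').
  apply: (@equipotent_trans _ _ _ _ (image_chain (@lspan K V) C)).
    apply: (@equipotent_rel _ _ _ _ (fun X W => W = @lspan K V X)).
    + by move=> X CX; exists (lspan X); split=> //; exists X.
    + by move=> W [X [CX ->]]; exists X.
    + by move=> X W W' _ _ _ -> ->.
    + move=> X X' W CX CX' _ -> E; case: Cch => -[Cn _] _.
      by rewrite -(nK X (Cn _ CX)) E nK //; apply: Cn.
  apply: (max_wo_chain_card glsub gup gtot gmin CL).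
  + exact: (witt_basis_free d wd hB).
  + exact: (witt_basis_total wd hB).
  + by move=> s; have [b [Bb bs]] := infB s; exists b; split=> //; left.
- have [C' [C'max CC']] := wo_chain_extend glsub gup gtot gmin
    (wo_chain_image niceL spanM Cmax).
  exists (image_chain (@points K V F) C'); split.
    exact: max_wo_chain_image goodP niceL pointsM spanM gK nK C'max.
  move=> X CX; exists (lspan X); split; first by apply: CC'; exists X.
  by rewrite nK //; case: Cmax => -[+ _] _; apply.
Qed.
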